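(* Let $\alpha > -1$. If $0< \sigma < \alpha+1$, then $$ K^{\alpha,\sigma}(x,y) \simeq (x+y)^{-2\alpha-1} \begin{cases} |x-y|^{2\sigma-1}, & \sigma< 1/2,\\ \log \frac{2(x+y)}{|x-y|}, & \sigma=1/2,\\ (x+y)^{2\sigma-1}, & \sigma>1/2, \end{cases} $$ uniformly in $x,y > 0$. If $\sigma \ge \alpha +1$, then $K^{\alpha,\sigma}(x,y)=\infty$ for all $x,y>0$.
   Context: For $\alpha>-1$ let $I_\alpha$ denote the modified Bessel function of the first kind of order $\alpha$, and for $t,x,y>0$ let $$W_t^{\alpha}(x,y)=\frac{1}{2t}\exp\Big(-\frac{x^2+y^2}{4t}\Big)(xy)^{-\alpha}I_\alpha\Big(\frac{xy}{2t}\Big).$$ For $\sigma>0$ and $x,y>0$ define the (Riesz) potential kernel $$K^{\alpha,\sigma}(x,y)=\frac1{\Gamma(\sigma)}\int_0^\infty W_t^\alpha(x,y)\,t^{\sigma-1}\,dt\in(0,\infty].$$ $X\simeq Y$ means $C^{-1}Y\le X\le CY$ with a constant $C>0$ independent of $x,y$ (it may depend on $\alpha,\sigma$). Positive expressions are valued in $[0,\infty]$, with natural limiting interpretations, e.g. $0^{\beta}=\infty$ for $\beta<0$, and $\log\frac{2(x+y)}{|x-y|}=\infty$ for $x=y$. *)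

(* Defs.v *)
From HB Require Import structures.
From mathcomp Require Import all_boot all_order all_algebra.
From mathcomp Require Import all_classical all_reals all_analysis.
Set Implicit Arguments.
Unset Strict Implicit.
Unset Printing Implicit Defensive.
Import Order.TTheory GRing.Theory Num.Theory.
Import numFieldNormedType.Exports.
Local Open Scope classical_set_scope.
Local Open Scope ring_scope.

(* Euler's Gamma function; only meaningful for s > 0, where the integral is
   finite. *)
Definition Gamma (R : realType) (s : R) : R :=
  \int[lebesgue_measure]_(t in `]0, +oo[) (t `^ (s - 1) * expR (- t)).

(* Modified Bessel function of the first kind of order a, for a > -1 and z > 0
   (so that Gamma is only evaluated at positive arguments):
     I_a(z) = sum_{k >= 0} (z/2)^(2k+a) / (k! Gamma(k+a+1)). *)
Definition besselI (R : realType) (a z : R) : R :=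
  limn (series (fun k : nat =>
    (z / 2) `^ (2 * k%:R + a) / (k`!%:R * Gamma (k%:R + a + 1)))).

Definition heat_kernel (R : realType) (a t x y : R) : R :=
  (2 * t)^-1 * expR (- ((x ^+ 2 + y ^+ 2) / (4 * t)))
  * (x * y) `^ (- a) * besselI a (x * y / (2 * t)).

Definition potential_kernel (R : realType) (a sigma x y : R) : \bar R :=
  ((Gamma sigma)^-1%:E *
   \int[lebesgue_measure]_(t in `]0%R, +oo[)
     (heat_kernel a t x y * t `^ (sigma - 1))%:E)%E.

(* r ^ b for r >= 0, valued in [0, +oo] with 0 ^ b = +oo for b < 0; the
   library's powR has 0 `^ b = 0 there. *)
Definition epow (R : realType) (r b : R) : \bar R :=
  if (r == 0) && (b < 0) then +oo%E else (r `^ b)%:E.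

(* f ~ g on D: two-sided comparability with one constant for all points of D. *)
Definition comparable_on (R : realType) (T : Type) (D : set T)
    (f g : T -> \bar R) : Prop :=
  exists2 C : R, 0 < C &
    forall p, D p -> (C^-1%:E * g p <= f p)%E /\ (f p <= C%:E * g p)%E.

(* Main.v *)
Require Import Defs.
From HB Require Import structures.
From mathcomp Require Import all_boot all_order all_algebra.
From mathcomp Require Import all_classical all_reals all_analysis.
From mathcomp Require Import measurable_realfun ring lra.
Set Implicit Arguments.
Unset Strict Implicit.
Unset Printing Implicit Defensive.
Import Order.TTheory GRing.Theory Num.Theory.
Import numFieldNormedType.Exports.
Local Open Scope classical_set_scope.
Local Open Scope ring_scope.
Local Notation mu := lebesgue_measure.

(** No asymptotics of the Bessel function are used: the potential kernel is
    computed exactly as a power series in one variable.  All terms of the Bessel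
    series are positive, so Tonelli's theorem allows integrating the heat kernel
    in t term by term, and each term is an inverse-power integral
      int_0^oo t^(-r-1) exp(-B/t) dt = Gamma(r) B^(-r),
    which is finite exactly when r > 0.  Here r = 2k + b with
    b = alpha + 1 - sigma and B = S/4 with S = x^2 + y^2.  When sigma is at least
    alpha + 1 the term k = 0 already diverges (potential_kernel_oo).  Otherwise
    (potential_kernel_series)
      K(x, y) = const * S^(-b) * F(u),   u = (2xy/S)^2,
      F(u) = sum_k q_k u^k,
      q_k = Gamma(2k + b) / (4^k k! Gamma(k + alpha + 1)).

    The functional equation of Gamma gives
      q_(k+1) / q_k = (k + b/2)(k + (b+1)/2) / ((k + 1)(k + alpha + 1)),
    hence q_k behaves like k^(-sigma - 1/2), and the trichotomy in sigma is that
    of the behaviour of F at u = 1.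
    - For sigma < 1/2 the q_k are comparable to the coefficients of the binomial
      series of (1 - u)^(sigma - 1/2), so F has that size.
    - For sigma = 1/2 they are comparable to 1/k, so F is comparable to
      1 - ln(1 - u).
    - For sigma > 1/2 they are summable by Raabe's test, so F is comparable to 1.
    The first two comparisons need no Stirling formula: the quotient r_k of two
    such coefficient sequences satisfies a recurrence whose ratio is
    1 + O(1/k^2), because the linear terms cancel, and is therefore bounded
    (quad_ratio_comparable).

    Finally 1 - u = (|x - y| (x + y) / S)^2 and S is comparable to (x + y)^2,
    which turns the estimates of F into those of the theorem.  On the diagonal
    u = 1, and F(1) is infinite for sigma <= 1/2 since F is monotone and unbounded
    on [0, 1). *)

(** * Integration over the positive half-line *)

Lemma bigcup_itv_pos (R : realType) (c d : R) : 0 < c -> 0 < d ->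
  \bigcup_n `[c / n.+1%:R, d * n.+1%:R]%classic = `]0, +oo[%classic :> set R.
Proof.
move=> c0 d0; apply/seteqP; split=> [t [n _] /=|t /=].
  rewrite !in_itv/= andbT => /andP[+ _]; apply: lt_le_trans.
  by rewrite divr_gt0.
rewrite in_itv/= andbT => t0.
(* Large enough for both c / (n+1) <= t and t <= d (n+1). *)
exists (Num.trunc (c / t) + Num.trunc (t / d))%N => //=.
rewrite in_itv/=; apply/andP; split.
  rewrite ler_pdivrMr// mulrC -ler_pdivrMr//.
  apply: le_trans (ltW (truncnS_gt _)) _; rewrite ler_nat ltnS; exact: leq_addr.
rewrite mulrC -ler_pdivrMr//.
apply: le_trans (ltW (truncnS_gt _)) _; rewrite ler_nat ltnS; exact: leq_addl.
Qed.

Lemma measurable_fun_pos_continuous (R : realType) (f : R -> R) :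
  (forall t : R, 0 < t -> {for t, continuous f}) -> measurable_fun (`]0, +oo[ : set R) f.
Proof.
move=> cf; apply: open_continuous_measurable_fun; first exact: interval_open.
by move=> t /[!inE]/=; rewrite in_itv/= andbT; exact: cf.
Qed.

(** Substitution and the fundamental theorem of calculus are available on compact
    intervals; this exhaustion transfers them to the open half-line, where the
    integrands may be singular at both ends.  The endpoints carry constants c and d
    because an inversion maps one such exhaustion to another one. *)
Lemma cvg_integral_pos (R : realType) (f : R -> R) (c d : R) :
  0 < c -> 0 < d -> (forall t : R, 0 < t -> 0 <= f t) ->
  measurable_fun (`]0, +oo[ : set R) f ->
  (\int[mu]_(t in `[(c / n.+1%:R)%R, (d * n.+1%:R)%R]) (f t)%:E)%E
    @[n --> \oo] --> (\int[mu]_(t in `]0%R, +oo[) (f t)%:E)%E.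
Proof.
move=> c0 d0 f0 mf; rewrite -(@bigcup_itv_pos _ c d)//.
have pos n t : t \in `[c / n.+1%:R, d * n.+1%:R] -> 0 < t.
  by rewrite in_itv/= => /andP[+ _]; apply: lt_le_trans; rewrite divr_gt0.
apply: ge0_nondecreasing_set_cvg_integral => //.
- apply/nondecreasing_seqP => n; rewrite subsetEset => t /=.
  rewrite !in_itv/= => /andP[h1 h2]; apply/andP; split.
    by apply: le_trans h1; rewrite ler_pM2l// lef_pV2 ?posrE// ler_nat.
  by apply: le_trans h2 _; rewrite ler_pM2l// ler_nat.
- move=> n; apply/measurable_EFinP; apply: measurable_funS mf => //.
  by move=> t /= /pos; rewrite in_itv/= andbT.
- by move=> n t /= /pos/f0; rewrite lee_fin.
Qed.

(** The map v |-> B / v sends [1/(n+1), n+1] onto [B/(n+1), B(n+1)], so the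
    change of variables on compact intervals passes to the limit on both sides. *)
Lemma integral_inversion (R : realType) (B : R) (G : R -> R) : 0 < B ->
  (forall t : R, 0 < t -> 0 <= G t) -> (forall t : R, 0 < t -> {for t, continuous G}) ->
  (\int[mu]_(t in `]0%R, +oo[) (G t)%:E =
   \int[mu]_(v in `]0%R, +oo[) (G (B / v) * (B / v ^+ 2))%:E)%E.
Proof.
move=> B0 G0 cG.
have cV (v : R) : 0 < v -> {for v, continuous (fun v : R => B / v)}.
  by move=> v0; apply: cvgM; [exact: cvg_cst|apply: cvgV => //; rewrite gt_eqF].
have cH (v : R) : 0 < v -> {for v, continuous (fun v : R => G (B / v) * (B / v ^+ 2))}.
  move=> v0; apply: cvgM.
    by apply: continuous_comp; [exact: cV|apply: cG; rewrite divr_gt0].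
  apply: cvgM; first exact: cvg_cst.
  apply: cvgV; first by rewrite gt_eqF// exprn_gt0.
  exact: exprn_continuous.
have dV (v : R) : 0 < v -> is_derive v 1 (fun v : R => B / v) (- (B / v ^+ 2)).
  move=> v0.
  have vn0 : v != 0 by rewrite gt_eqF.
  have h := @is_deriveZ _ _ _ _ B _ _ _ (@is_deriveV _ id v 1 1 vn0 (is_derive_id _ _)).
  by apply: (is_derive_eq h); rewrite /GRing.scale/= mulr1 mulrN.
pose F v := B / v.
have F'E (v : R) : 0 < v -> derive1 F v = - (B / v ^+ 2).
  by move=> v0; rewrite derive1E; exact: (@derive_val _ _ _ _ _ _ _ (dV v v0)).
have cF' (v : R) : 0 < v -> derive1 F x @[x --> v] --> derive1 F v.
  move=> v0; rewrite F'E//.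
  have : - (B / x ^+ 2) @[x --> v] --> - (B / v ^+ 2).
    apply: cvgN; apply: cvgM; first exact: cvg_cst.
    apply: cvgV; first by rewrite gt_eqF// exprn_gt0.
    exact: exprn_continuous.
  apply: cvg_trans; apply: near_eq_cvg; near=> x; rewrite F'E//.
  by near: x; exact: lt_nbhsr.
have h1 := @cvg_integral_pos _ G B B B0 B0 G0 (measurable_fun_pos_continuous cG).
have h2 := @cvg_integral_pos _ _ 1 1 ltr01 ltr01 _ (measurable_fun_pos_continuous cH).
apply: (cvg_unique _ h1) => //.
have -> : (fun n =>
    \int[mu]_(t in `[(B / n.+1%:R)%R, (B * n.+1%:R)%R]) (G t)%:E)%E =
  (fun n => \int[mu]_(v in `[(1 / n.+1%:R)%R, (1 * n.+1%:R)%R])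
    (G (B / v) * (B / v ^+ 2))%:E)%E.
  apply/funext => n.
  have n0 : 0 < n.+1%:R^-1 :> R by rewrite invr_gt0.
  have n1 : n.+1%:R^-1 <= n.+1%:R :> R.
    by rewrite (@le_trans _ _ 1)// ?invf_le1// ler1n.
  have pos t : t \in `[n.+1%:R^-1, (n.+1%:R : R)] -> 0 < t.
    by rewrite in_itv/= => /andP[+ _]; apply: lt_le_trans.
  have := @integration_by_substitution_decreasing _ F G _ _ n1.
  have -> : F n.+1%:R^-1 = B * n.+1%:R by rewrite /F invrK.
  rewrite mul1r mul1r => ->.
  - apply: eq_integral => v /[!inE] /pos v0; congr EFin => /=.
    by rewrite /= !fctE F'E// opprK.
  - move=> x y /pos x0 /pos y0 xy; rewrite /F ltr_pM2l// ltf_pV2//.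
  - move=> x /(subset_itvW _ _ (lexx _) (lexx _))/pos x0; exact: cF'.
  - apply/cvg_ex; exists (derive1 F (n.+1%:R^-1)).
    by apply: cvg_at_right_filter; exact: cF'.
  - apply/cvg_ex; exists (derive1 F (n.+1%:R)).
    by apply: cvg_at_left_filter; exact: cF'.
  - split.
    + move=> x /(subset_itvW _ _ (lexx _) (lexx _))/pos x0.
      exact: (@ex_derive _ _ _ _ _ _ _ (dV x x0)).
    + by apply: cvg_at_right_filter; exact: cV.
    + by apply: cvg_at_left_filter; exact: cV.
  - apply: continuous_in_subspaceT => x /[!inE]/=; rewrite in_itv/= => /andP[h _].
    by apply: cG; apply: lt_le_trans h; rewrite divr_gt0.
by apply: h2 => t t0; rewrite mulr_ge0// ?G0 ?divr_gt0// ltW// divr_gt0// exprn_gt0.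
Unshelve. all: by end_near. Qed.

Lemma integral_itv_FTC_sub (R : realType) (F f1 f2 : R -> R) (a b : R) :
  0 < a -> a <= b ->
  (forall t : R, 0 < t -> {for t, continuous f1}) ->
  (forall t : R, 0 < t -> {for t, continuous f2}) ->
  (forall t : R, 0 < t -> is_derive t 1 F (f1 t - f2 t)) ->
  (\int[mu]_(t in `[a, b]) (f1 t)%:E =
   \int[mu]_(t in `[a, b]) (f2 t)%:E + (F b - F a)%:E)%E.
Proof.
move=> a0; rewrite le_eqVlt => /predU1P[<- _ _ _|ab c1 c2 dF].
  by rewrite set_itv1 !integral_set1 subrr adde0.
have pos t : t \in `[a, b] -> 0 < t.
  by rewrite in_itv/= => /andP[+ _]; exact: lt_le_trans.
have cF t : 0 < t -> {for t, continuous F}.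
  move=> t0; apply: differentiable_continuous; apply/derivable1_diffP.
  exact: (@ex_derive _ _ _ _ _ _ _ (dF t t0)).
have cw (f : R -> R) : (forall t : R, 0 < t -> {for t, continuous f}) ->
    {within `[a, b], continuous f}.
  by move=> cf; apply: continuous_in_subspaceT => x /[!inE]/= /pos; exact: cf.
have itg (f : R -> R) : (forall t : R, 0 < t -> {for t, continuous f}) ->
    lebesgue_measure.-integrable `[a, b] (EFin \o f).
  move=> cf; apply: continuous_compact_integrable; first exact: segment_compact.
  exact: cw.
have : (\int[mu]_(t in `[a, b]) (f1 t - f2 t)%:E = (F b)%:E - (F a)%:E)%E.
  apply: continuous_FTC2 => //.
  - by apply: cw => t t0; apply: cvgB; [exact: c1|exact: c2].
  - split.
    + move=> x /(subset_itvW _ _ (lexx _) (lexx _))/pos x0.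
      exact: (@ex_derive _ _ _ _ _ _ _ (dF x x0)).
    + by apply: cvg_at_right_filter; exact: cF.
    + by apply: cvg_at_left_filter; apply: cF; exact: lt_trans ab.
  - move=> x /(subset_itvW _ _ (lexx _) (lexx _))/pos x0; rewrite derive1E.
    exact: (@derive_val _ _ _ _ _ _ _ (dF x x0)).
under eq_integral do rewrite EFinB.
have -> := @integralB_EFin _ _ _ lebesgue_measure `[a, b]%classic f1 f2 _
  (itg _ c1) (itg _ c2) => //.
rewrite EFinB => <-.
by rewrite addeC subeK//; apply: integrable_fin_num => //; exact: itg.
Qed.

(** The derivative is split as a difference of nonnegative functions so that the
    identity holds in [0, +oo] without integrability: it can then prove the
    functional equation of Gamma before Gamma is known to be finite. *)
Lemma integral_pos_FTC (R : realType) (F f1 f2 : R -> R) (l m : R) :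
  (forall t : R, 0 < t -> 0 <= f1 t) -> (forall t : R, 0 < t -> 0 <= f2 t) ->
  (forall t : R, 0 < t -> {for t, continuous f1}) ->
  (forall t : R, 0 < t -> {for t, continuous f2}) ->
  (forall t : R, 0 < t -> is_derive t 1 F (f1 t - f2 t)) ->
  F t @[t --> 0^'+] --> m -> F t @[t --> +oo] --> l ->
  (\int[mu]_(t in `]0%R, +oo[) (f1 t)%:E =
   \int[mu]_(t in `]0%R, +oo[) (f2 t)%:E + (l - m)%:E)%E.
Proof.
move=> f10 f20 c1 c2 dF F0 Fy.
have h1 := cvg_integral_pos ltr01 ltr01 f10 (measurable_fun_pos_continuous c1).
have h2 := cvg_integral_pos ltr01 ltr01 f20 (measurable_fun_pos_continuous c2).
have n0 n : 0 < n.+1%:R^-1 :> R by rewrite invr_gt0.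
have n1 n : n.+1%:R^-1 <= n.+1%:R :> R.
  by rewrite (@le_trans _ _ 1)// ?invf_le1// ler1n.
have hF : F n.+1%:R - F n.+1%:R^-1 @[n --> \oo] --> l - m.
  apply: cvgB.
    apply: cvg_comp Fy; apply/cvgryPge => A; near=> n.
    apply: le_trans (ltW (truncnS_gt _)) _; rewrite ler_nat ltnS.
    by near: n; exact: nbhs_infty_ge.
  move/cvg_at_rightP : F0; apply; split => //.
  exact: cvg_harmonic.
apply: (cvg_unique _ h1) => //.
have hFE : (F n.+1%:R - F n.+1%:R^-1)%:E @[n --> \oo] --> (l - m)%:E.
  by apply: cvg_EFin => //; exact: nearW.
have := cvgeD (fin_num_adde_defl _ _) h2 hFE.
move=> /(_ _ erefl) h; apply: (cvg_trans _ h); apply: near_eq_cvg.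
apply: nearW => n; rewrite !mul1r.
by rewrite (integral_itv_FTC_sub (n0 n) (n1 n) c1 c2 dF).
Unshelve. all: by end_near. Qed.

(** * Euler's Gamma integral and its inverse-power form *)

Lemma continuous_powR_pos (R : realType) (p t : R) :
  0 < t -> {for t, continuous (fun t : R => t `^ p)}.
Proof.
move=> t0; apply: differentiable_continuous; apply/derivable1_diffP.
exact: (@ex_derive _ _ _ _ _ _ _ (is_derive1_powR p t0)).
Qed.

(** This is ln z < z at z = t / (2p), multiplied by p and exponentiated. *)
Lemma powR_le_expR (R : realType) (p t : R) : 0 < p -> 0 < t ->
  t `^ p <= (2 * p) `^ p * expR (t / 2).
Proof.
move=> p0 t0.
have p2 : 0 < 2 * p by rewrite mulr_gt0.
have -> : t `^ p = (2 * p) `^ p * (t / (2 * p)) `^ p.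
  by rewrite -powRM ?divr_ge0 ?ltW// mulrC divfK// gt_eqF.
apply: ler_wpM2l; first exact: powR_ge0.
rewrite {1}/powR gt_eqF ?divr_gt0// ler_expR.
have : p * ln (t / (2 * p)) <= p * (t / (2 * p)).
  by rewrite ler_pM2l// ltW// ln_sublinear// divr_gt0.
by congr (_ <= _); field; rewrite gt_eqF.
Qed.

Lemma cvg_expRN_scale (R : realType) (c : R) : 0 < c ->
  expR (- (c * t)) @[t --> +oo] --> (0 : R).
Proof.
move=> c0; apply: (@cvg_comp _ _ _ (fun t => c * t) (fun t => expR (- t)) _ +oo).
  exact: gt0_cvgMry.
exact: cvgr_expR.
Qed.

Lemma is_derive_expRN_scale (R : realType) (c t : R) :
  is_derive t 1 (fun t : R => expR (- (c * t))) (- (c * expR (- (c * t)))).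
Proof.
have h1 : is_derive t 1 (fun t : R => - (c * t)) (- c).
  have h := @is_deriveZ _ _ _ _ (- c) _ _ _ (is_derive_id t 1).
  have -> : (fun t : R => - (c * t)) = - c \*: id.
    by apply/funext => z; rewrite /= /GRing.scale/= mulNr.
  by apply: (is_derive_eq h); rewrite /GRing.scale/= mulr1.
apply: (is_derive_eq (is_derive1_comp (is_derive_expR _) h1)).
by rewrite mulrN mulrC.
Qed.

Lemma continuous_expRN_scale (R : realType) (c t : R) :
  {for t, continuous (fun t : R => expR (- (c * t)))}.
Proof.
apply: differentiable_continuous; apply/derivable1_diffP.
exact: (@ex_derive _ _ _ _ _ _ _ (is_derive_expRN_scale c t)).
Qed.

Lemma integral_expRN_half (R : realType) :
  (\int[mu]_(t in `]0%R, +oo[) (expR (- (2^-1 * t)))%:E = (2 : R)%:E)%E.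
Proof.
have := @integral_pos_FTC R (fun t => -2 * expR (- (2^-1 * t)))
  (fun t => expR (- (2^-1 * t))) (fun=> 0) 0 (-2).
rewrite integral0 add0e sub0r opprK; apply => //.
- by move=> t _; exact: continuous_expRN_scale.
- by move=> t _; exact: cvg_cst.
- move=> t _.
  have h := @is_deriveZ _ _ _ _ (-2) _ _ _ (is_derive_expRN_scale 2^-1 t).
  by apply: (is_derive_eq h); rewrite /GRing.scale/= subr0; field.
- rewrite -[X in _ --> X]mulr1; apply: cvgMr.
  have h : expR (- (2^-1 * t)) @[t --> (0 : R)] --> expR (- (2^-1 * 0)).
    exact: continuous_expRN_scale.
  by rewrite mulr0 oppr0 expR0 in h; exact: cvg_at_right_filter.
- rewrite -[X in _ --> X](mulr0 (-2)); apply: cvgMr.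
  by apply: cvg_expRN_scale; rewrite invr_gt0.
Qed.

Section gamma.
Variable R : realType.
Implicit Types s t B : R.

Definition gamma_int s : \bar R :=
  (\int[mu]_(t in `]0%R, +oo[) (t `^ (s - 1) * expR (- t))%:E)%E.

Lemma continuous_gamma_integrand p B t : 0 < t ->
  {for t, continuous (fun t : R => t `^ p * expR (- (B * t)))}.
Proof.
move=> t0; apply: cvgM; first exact: continuous_powR_pos.
exact: continuous_expRN_scale.
Qed.

Lemma gamma_int_ge0 s : (0 <= gamma_int s)%E.
Proof.
by apply: integral_ge0 => t _; rewrite lee_fin mulr_ge0 ?powR_ge0 ?expR_ge0.
Qed.

Lemma measurable_gamma_integrand p B :
  measurable_fun (`]0, +oo[ : set R) (fun t => t `^ p * expR (- (B * t))).
Proof.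
by apply: measurable_fun_pos_continuous => t; exact: continuous_gamma_integrand.
Qed.

Lemma gamma_integrand1 p :
  (fun t => t `^ p * expR (- t)) = fun t => t `^ p * expR (- (1 * t)).
Proof. by apply/funext => t; rewrite mul1r. Qed.

(** Integrates the derivative of t^s exp(-t), whose limits at 0 and at infinity
    both vanish. *)
Lemma gamma_int_rec s : 0 < s -> gamma_int (s + 1) = (s%:E * gamma_int s)%E.
Proof.
move=> s0; rewrite /gamma_int addrK -ge0_integralZl_EFin//; last 3 first.
- by move=> t _; rewrite lee_fin mulr_ge0 ?powR_ge0 ?expR_ge0.
- apply/measurable_EFinP; rewrite gamma_integrand1.
  exact: measurable_gamma_integrand.
- exact: ltW.
have c (p : R) t : 0 < t -> {for t, continuous (fun t : R => t `^ p * expR (- t))}.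
  by move=> t0; rewrite gamma_integrand1; exact: continuous_gamma_integrand.
have := @integral_pos_FTC R (fun t => t `^ s * expR (- t))
  (fun t => s * (t `^ (s - 1) * expR (- t))) (fun t => t `^ s * expR (- t)) 0 0.
rewrite subrr adde0 => E; apply/esym/E => {E} //.
- by move=> t _; rewrite !mulr_ge0 ?powR_ge0 ?expR_ge0 ?ltW.
- by move=> t _; rewrite mulr_ge0 ?powR_ge0 ?expR_ge0.
- by move=> t t0; apply: cvgMr; exact: c.
- by move=> t t0; exact: c.
- move=> t t0.
  have hE : is_derive t 1 (fun t : R => expR (- t)) (- expR (- t)).
    have -> : (fun t : R => expR (- t)) = fun t => expR (- (1 * t)).
      by apply/funext => z; rewrite /= mul1r.
    by apply: (is_derive_eq (is_derive_expRN_scale 1 t)); rewrite !mul1r.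
  have h := @is_deriveM _ _ _ _ _ _ _ _ (is_derive1_powR s t0) hE.
  by apply: (is_derive_eq h); rewrite /GRing.scale/= mulrN addrC; congr (_ - _); ring.
- apply: (@squeeze_cvgr _ _ _ _ (fun=> 0) (fun t => t `^ s)).
  + near=> t; rewrite mulr_ge0 ?powR_ge0 ?expR_ge0//= ler_piMr ?powR_ge0//.
    by rewrite expR_le1 oppr_le0.
  + exact: cvg_cst.
  + exact: powR_cvg0.
- apply: (@squeeze_cvgr _ _ _ _ (fun=> 0) (fun t => (2 * s) `^ s * expR (- (2^-1 * t)))).
  + near=> t; rewrite mulr_ge0 ?powR_ge0 ?expR_ge0//=.
    apply: (@le_trans _ _ ((2 * s) `^ s * expR (t / 2) * expR (- t))).
      by rewrite ler_wpM2r ?expR_ge0// powR_le_expR.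
    rewrite -mulrA -expRD ler_wpM2l ?powR_ge0// ler_expR.
    by lra.
  + exact: cvg_cst.
  + rewrite -[X in _ --> X](mulr0 ((2 * s) `^ s)); apply: cvgMr.
    by apply: cvg_expRN_scale; rewrite invr_gt0.
Unshelve. all: by end_near. Qed.

(** The recurrence reduces finiteness at s to finiteness at s + 1, where the
    integrand has no singularity at 0 and is dominated by a multiple of
    exp(-t/2). *)
Lemma gamma_int_lty s : 0 < s -> (gamma_int s < +oo)%E.
Proof.
move=> s0.
suff : (gamma_int (s + 1) < +oo)%E.
  rewrite gamma_int_rec//; have := gamma_int_ge0 s.
  by case: (gamma_int s) => // [r|]; rewrite ?ltry// gt0_muley ?lte_fin.
rewrite /gamma_int addrK.
apply: (@le_lt_trans _ _ (\int[mu]_(t in `]0%R, +oo[)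
    (((2 * s) `^ s)%:E * (expR (- (2^-1 * t)))%:E))%E).
  apply: ge0_le_integral => //.
  - by move=> t _; rewrite lee_fin mulr_ge0 ?powR_ge0 ?expR_ge0.
  - apply/measurable_EFinP; rewrite gamma_integrand1.
    exact: measurable_gamma_integrand.
  - have : measurable_fun (`]0, +oo[ : set R)
        (fun t => (2 * s) `^ s * expR (- (2^-1 * t))).
      apply: measurable_fun_pos_continuous => t t0.
      by apply: cvgMr; exact: continuous_expRN_scale.
    by move/measurable_EFinP.
  - move=> t /=; rewrite in_itv/= andbT => t0; rewrite -EFinM lee_fin.
    apply: (@le_trans _ _ ((2 * s) `^ s * expR (t / 2) * expR (- t))).
      by rewrite ler_wpM2r ?expR_ge0// powR_le_expR.
    by rewrite -mulrA -expRD ler_wpM2l ?powR_ge0// ler_expR; lra.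
rewrite ge0_integralZl_EFin ?powR_ge0//; last first.
  apply/measurable_EFinP; apply: measurable_fun_pos_continuous => t t0.
  exact: continuous_expRN_scale.
by rewrite integral_expRN_half -EFinM ltry.
Qed.

Lemma GammaE s : 0 < s -> (Gamma s)%:E = gamma_int s.
Proof.
move=> s0; rewrite /Gamma /Rintegral fineK//.
by rewrite ge0_fin_numE ?gamma_int_ge0//; exact: gamma_int_lty.
Qed.

Lemma GammaS s : 0 < s -> Gamma (s + 1) = s * Gamma s.
Proof.
move=> s0; apply: EFin_inj.
by rewrite EFinM !GammaE ?addr_gt0// gamma_int_rec.
Qed.

(** At s + 1 the integrand is at least exp(-2) on [1, 2]; the functional equation
    brings positivity back to s. *)
Lemma Gamma_gt0 s : 0 < s -> 0 < Gamma s.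
Proof.
move=> s0; suff : 0 < Gamma (s + 1) by rewrite GammaS// pmulr_rgt0.
rewrite -lte_fin GammaE ?addr_gt0// /gamma_int addrK.
apply: (@lt_le_trans _ _ (\int[mu]_(t in `[1%R, 2%R]) (expR (- 2))%:E)%E).
  rewrite integral_cst//= lebesgue_measure_itv/= lte_fin ltr1n/= -EFinB -EFinM lte_fin.
  by rewrite mulr_gt0 ?expR_gt0// subr_gt0 ltr1n.
apply: (@le_trans _ _ (\int[mu]_(t in `[1%R, 2%R]) (t `^ s * expR (- t))%:E)%E).
  apply: ge0_le_integral => //.
  - apply/measurable_EFinP; rewrite gamma_integrand1.
    apply: measurable_funS (measurable_gamma_integrand s 1) => //.
    move=> t /=; rewrite !in_itv/= andbT => /andP[+ _]; exact: lt_le_trans.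
  - move=> t /=; rewrite in_itv/= => /andP[t1 t2]; rewrite lee_fin.
    rewrite -[leLHS]mul1r ler_pM ?expR_ge0// ?ler_expR ?lerN2//.
    by rewrite -(powRr0 t) ler_powR// ltW.
apply: ge0_subset_integral => //.
- apply/measurable_EFinP; rewrite gamma_integrand1.
  exact: measurable_gamma_integrand.
- by move=> t _; rewrite lee_fin mulr_ge0 ?powR_ge0 ?expR_ge0.
- move=> t /=; rewrite !in_itv/= andbT => /andP[+ _]; exact: lt_le_trans.
Qed.

Lemma continuous_inv_integrand p B t : 0 < t ->
  {for t, continuous (fun t : R => t `^ p * expR (- (B / t)))}.
Proof.
move=> t0; apply: cvgM; first exact: continuous_powR_pos.
apply: (@cvg_comp _ _ _ (fun t => t^-1) (fun t => expR (- (B * t))) _ (nbhs t^-1)).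
  by apply: cvgV => //; rewrite gt_eqF.
exact: continuous_expRN_scale.
Qed.

(** The inversion t = B / v turns this into Euler's integral. *)
Lemma integral_inv_gamma s B : 0 < s -> 0 < B ->
  (\int[mu]_(t in `]0%R, +oo[) (t `^ (- s - 1) * expR (- (B / t)))%:E
   = (Gamma s * B `^ (- s))%:E)%E.
Proof.
move=> s0 B0.
rewrite (@integral_inversion _ B)//; last 2 first.
- by move=> t _; rewrite mulr_ge0 ?powR_ge0 ?expR_ge0.
- by move=> t; exact: continuous_inv_integrand.
rewrite mulrC EFinM GammaE// -ge0_integralZl_EFin ?powR_ge0//; last 2 first.
- by move=> t _; rewrite lee_fin mulr_ge0 ?powR_ge0 ?expR_ge0.
- apply/measurable_EFinP; rewrite gamma_integrand1.
  exact: measurable_gamma_integrand.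
apply: eq_integral => v /[!inE]/=; rewrite in_itv/= andbT => v0.
have vn0 : v != 0 by rewrite gt_eqF.
have Bn0 : B != 0 by rewrite gt_eqF.
rewrite -EFinM; congr EFin.
have -> : B / (B / v) = v by field; rewrite Bn0 vn0.
rewrite powRM ?invr_ge0 ?ltW// -[v^-1 in LHS]powR_inv1 ?ltW// -powRrM.
have -> : -1 * (- s - 1) = s - 1 + 2%:R :> R by ring.
have -> : v `^ (s - 1 + 2%:R) = v `^ (s - 1) * v `^ 2%:R.
  by rewrite powRD// vn0 implybT.
have -> : B `^ (- s - 1) = B `^ (- s) * B `^ (- 1).
  by rewrite powRD// Bn0 implybT.
rewrite powR_mulrn ?ltW// powR_inv1 ?ltW//.
by field; rewrite Bn0 vn0.
Qed.

(** Inverting with B = 1 reduces the scaled Euler integral to the preceding one. *)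
Lemma integral_gamma_scale s B : 0 < s -> 0 < B ->
  (\int[mu]_(t in `]0%R, +oo[) (t `^ (s - 1) * expR (- (B * t)))%:E
   = (Gamma s * B `^ (- s))%:E)%E.
Proof.
move=> s0 B0.
rewrite (@integral_inversion _ 1)//; last 2 first.
- by move=> t _; rewrite mulr_ge0 ?powR_ge0 ?expR_ge0.
- by move=> t; exact: continuous_gamma_integrand.
rewrite -integral_inv_gamma//.
apply: eq_integral => v /[!inE]/=; rewrite in_itv/= andbT => v0.
have vn0 : v != 0 by rewrite gt_eqF.
congr EFin; rewrite !mul1r mulrAC; congr (_ * _).
rewrite -[v^-1]powR_inv1 ?ltW// -powRrM -powR_invn ?ltW// -powRD ?vn0 ?implybT//.
by congr (_ `^ _); ring.
Qed.

(** For s <= 0 the integrand is at least exp(-B) / t on [1, +oo[, so the integral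
    diverges logarithmically. *)
Lemma integral_inv_gamma_oo s B : s <= 0 -> 0 < B ->
  (\int[mu]_(t in `]0%R, +oo[) (t `^ (- s - 1) * expR (- (B / t)))%:E
   = +oo)%E.
Proof.
move=> s0 B0; apply/eqyP => A A0.
have e0 : 0 < expR (- B) by exact: expR_gt0.
pose b := expR (A / expR (- B)).
have b1 : 1 <= b by rewrite -expR0 ler_expR divr_ge0 ?ltW.
apply: (@le_trans _ _ (\int[mu]_(t in `[1%R, b]) (expR (- B) * t^-1)%:E)%E).
  have -> : (\int[mu]_(t in `[1%R, b]) (expR (- B) * t^-1)%:E =
      (expR (- B) * ln b)%:E)%E.
    have := @integral_itv_FTC_sub R (fun t => expR (- B) * ln t)
      (fun t => expR (- B) * t^-1) (fun=> 0) _ _ ltr01 b1.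
    rewrite integral0 add0e ln1 mulr0 subr0; apply => //.
    - by move=> t t0; apply: cvgMr; apply: cvgV => //; rewrite gt_eqF.
    - by move=> t _; exact: cvg_cst.
    - move=> t t0.
      have h := @is_deriveZ _ _ _ _ (expR (- B)) _ _ _ (is_derive1_ln t0).
      by apply: (is_derive_eq h); rewrite /GRing.scale/= subr0.
  by rewrite /b expRK mulrC divfK// gt_eqF.
have sub : `[1%R, b]%classic `<=` (`]0, +oo[%classic : set R).
  by move=> t /=; rewrite !in_itv/= andbT => /andP[+ _]; exact: lt_le_trans.
have mI : measurable_fun (`]0, +oo[ : set R) (fun t => t `^ (- s - 1) * expR (- (B / t))).
  by apply: measurable_fun_pos_continuous => t; exact: continuous_inv_integrand.
apply: (@le_trans _ _ (\int[mu]_(t in `[1%R, b])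
    (t `^ (- s - 1) * expR (- (B / t)))%:E)%E).
  apply: ge0_le_integral => //.
  - move=> t /sub/=; rewrite in_itv/= andbT => t0.
    by rewrite lee_fin mulr_ge0 ?invr_ge0 ?expR_ge0// ltW.
  - apply/measurable_EFinP.
    apply: measurable_funS (_ : measurable_fun (`]0, +oo[ : set R) _) => //.
    apply: measurable_fun_pos_continuous => t t0.
    by apply: cvgMr; apply: cvgV => //; rewrite gt_eqF.
  - by apply/measurable_EFinP; apply: measurable_funS mI.
  - move=> t /=; rewrite in_itv/= => /andP[t1 _]; rewrite lee_fin mulrC.
    have t0 : 0 < t by exact: lt_le_trans t1.
    rewrite ler_pM ?invr_ge0 ?expR_ge0 ?(ltW t0)//.
      by rewrite -powR_inv1 ?(ltW t0)// ler_powR//; lra.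
    by rewrite ler_expR lerN2 ler_pdivrMr// ler_pMr.
apply: ge0_subset_integral => //; first exact/measurable_EFinP.
by move=> t _; rewrite lee_fin mulr_ge0 ?powR_ge0 ?expR_ge0.
Qed.

End gamma.

Local Opaque Gamma.

(** * The potential kernel as a power series *)

Lemma EFin_lim_series (R : realType) (u : nat -> R) : cvgn (series u) ->
  ((limn (series u))%:E = \sum_(k <oo) (u k)%:E)%E.
Proof.
move=> cu; rewrite -EFin_lim//; apply: congr_lim; apply/funext => n /=.
by rewrite /series/= sumEFin.
Qed.

Lemma powR_expR_ln (R : realType) (t p : R) : 0 < t -> t `^ p = expR (p * ln t).
Proof. by move=> t0; rewrite /powR gt_eqF. Qed.

Section bessel.
Variable R : realType.
Implicit Types a b s t x y z : R.

(** The factor k + a + 1 in the functional equation is at least 1 once k >= 1, so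
    Gamma(k + a + 1) is nondecreasing from k = 1 on; for -1 < a < 0 the value at
    k = 0 has to be treated apart. *)
Lemma Gamma_shift_ge a : -1 < a ->
  exists2 m : R, 0 < m & forall k : nat, m <= Gamma (k%:R + a + 1).
Proof.
move=> a1; have a10 : 0 < a + 1 by lra.
exists (Num.min (Gamma (a + 1)) (Gamma (a + 1 + 1))).
  by rewrite lt_min !Gamma_gt0//; lra.
case=> [|k]; first by rewrite add0r ge_min lexx.
rewrite ge_min; apply/orP; right; elim: k => [|k IH].
  by rewrite le_eqVlt; apply/orP; left; apply/eqP; congr Gamma; ring.
apply: le_trans IH _.
have k0 : 0 <= k%:R :> R by [].
have -> : k.+2%:R + a + 1 = (k.+1%:R + a + 1) + 1 :> R by rewrite -!natr1; ring.
have p : 1 <= k.+1%:R + a + 1 by rewrite -natr1; lra.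
rewrite (@GammaS _ (k.+1%:R + a + 1)) ?(lt_le_trans ltr01)// ler_peMl//.
by rewrite ltW// Gamma_gt0// (lt_le_trans ltr01).
Qed.

Definition bessel_term a z (k : nat) : R :=
  (z / 2) `^ (2 * k%:R + a) / (k`!%:R * Gamma (k%:R + a + 1)).

Lemma Gamma_shift_gt0 a (k : nat) : -1 < a -> 0 < Gamma (k%:R + a + 1).
Proof.
by move=> a1; apply: Gamma_gt0; rewrite -addrA ltr_wpDl//; lra.
Qed.

Lemma fact_gt0R (k : nat) : 0 < k`!%:R :> R.
Proof. by rewrite ltr0n fact_gt0. Qed.

Lemma bessel_term_ge0 a z k : -1 < a -> 0 <= bessel_term a z k.
Proof.
move=> a1; rewrite /bessel_term divr_ge0 ?powR_ge0// mulr_ge0//.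
by rewrite ltW// Gamma_shift_gt0.
Qed.

(** The limit defining the Bessel function is meaningful only if the series
    converges, which follows by domination by an exponential series. *)
Lemma besselI_series a z : -1 < a -> 0 < z ->
  ((besselI a z)%:E = \sum_(k <oo) (bessel_term a z k)%:E)%E.
Proof.
move=> a1 z0; apply: EFin_lim_series.
have [m m0 hm] := Gamma_shift_ge a1.
have z20 : 0 < z / 2 by rewrite divr_gt0.
pose C := (z / 2) `^ a / m.
apply: (@series_le_cvg _ _ (C *: exp_coeff ((z / 2) ^+ 2))).
- by move=> k; exact: bessel_term_ge0.
- move=> k; rewrite /exp_coeff /= /GRing.scale/= mulr_ge0//.
    by rewrite divr_ge0 ?powR_ge0 ?ltW.
  by rewrite divr_ge0// !exprn_ge0// ltW.
- move=> k; rewrite /exp_coeff /= /GRing.scale/= /C.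
  have -> : (z / 2) `^ (2 * k%:R + a) = (z / 2) ^+ 2 ^+ k * (z / 2) `^ a.
    rewrite powRD; last by rewrite (gt_eqF z20) implybT.
    by rewrite powRrM !powR_mulrn ?exprn_ge0// ltW.
  have -> : ((z / 2) `^ a / m) *: ((z / 2) ^+ 2 ^+ k / k`!%:R) =
     (z / 2) ^+ 2 ^+ k * (z / 2) `^ a / (k`!%:R * m).
    by rewrite [LHS]mulrACA invfM [X in X * _ = _]mulrC [X in _ * X = _]mulrC.
  apply: ler_wpM2l; first by rewrite mulr_ge0 ?powR_ge0// !exprn_ge0// ltW.
  rewrite lef_pV2 ?posrE ?mulr_gt0 ?Gamma_shift_gt0//.
  by rewrite ler_pM2l.
- by apply: is_cvg_seriesZ; exact: is_cvg_series_exp_coeff.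
Qed.

(** The coefficient of ((2xy/(x^2+y^2))^2)^k in the expansion of the potential
    kernel, with b = a + 1 - sigma. *)
Definition kernel_coef a b (k : nat) : R :=
  Gamma (2 * k%:R + b) / (4 ^+ k * k`!%:R * Gamma (k%:R + a + 1)).

Definition inv_gamma_int s B : \bar R :=
  (\int[mu]_(t in `]0%R, +oo[) (t `^ (- s - 1) * expR (- (B / t)))%:E)%E.

(** Term by term, the powers of t in the heat kernel, in the Bessel series and in
    the weight t^(sigma - 1) combine into t^(-r-1) with r = 2k + a + 1 - sigma.
    The values of the integrals are left in [0, +oo], so that one formula serves
    the convergent and the divergent range of sigma. *)
Lemma potential_kernel_Tonelli a sigma x y : -1 < a -> 0 < x -> 0 < y ->
  (potential_kernel a sigma x y = (Gamma sigma)^-1%:E *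
    \sum_(k <oo) ((2^-1 * (x * y) ^+ (2 * k) * 4 `^ (- (2 * k%:R + a))
        / (k`!%:R * Gamma (k%:R + a + 1)))%:E *
      inv_gamma_int (2 * k%:R + (a + 1 - sigma)) ((x ^+ 2 + y ^+ 2) / 4)))%E.
Proof.
move=> a1 x0 y0; rewrite /potential_kernel; congr (_ * _)%E.
pose A k : R := 2^-1 * (x * y) ^+ (2 * k) * 4 `^ (- (2 * k%:R + a))
        / (k`!%:R * Gamma (k%:R + a + 1)).
pose B := (x ^+ 2 + y ^+ 2) / 4.
pose f k t : R := t `^ (- (2 * k%:R + (a + 1 - sigma)) - 1) * expR (- (B / t)).
have A0 k : 0 <= A k.
  rewrite /A divr_ge0 ?mulr_ge0 ?powR_ge0 ?exprn_ge0 ?mulr_ge0 ?(ltW x0) ?(ltW y0)//.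
  by rewrite ltW// Gamma_shift_gt0.
have f0 k t : 0 <= f k t by rewrite mulr_ge0 ?powR_ge0 ?expR_ge0.
have mf k : measurable_fun (`]0, +oo[ : set R) (f k).
  by apply: measurable_fun_pos_continuous => t; exact: continuous_inv_integrand.
transitivity (\int[mu]_(t in `]0%R, +oo[)
    (\sum_(k <oo) ((A k)%:E * (f k t)%:E)))%E.
  apply: eq_integral => t /[!inE]/=; rewrite in_itv/= andbT => t0.
  rewrite /heat_kernel.
  set c := (2 * t)^-1 * _ * _.
  have xy0 : 0 < x * y by rewrite mulr_gt0.
  have c0 : 0 <= c by rewrite !mulr_ge0 ?powR_ge0 ?expR_ge0// invr_ge0 mulr_ge0// ltW.
  rewrite mulrAC EFinM besselI_series//; last by rewrite divr_gt0// mulr_gt0.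
  rewrite -nneseriesZl; last by move=> k _; rewrite lee_fin bessel_term_ge0.
  apply: eq_eseriesr => k _; rewrite -!EFinM; congr EFin.
  rewrite /c /A /f /bessel_term.
  set G := k`!%:R * _.
  have -> : x * y / (2 * t) / 2 = x * y * 4^-1 * t^-1 by field; rewrite gt_eqF.
  have -> : B / t = (x ^+ 2 + y ^+ 2) / (4 * t) by rewrite /B; field; rewrite gt_eqF.
  rewrite -(powR_mulrn (2 * k)) ?ltW//.
  have -> : (2 * t)^-1 = 2^-1 * t `^ (-1) by rewrite powR_inv1 ?ltW// invfM.
  set e := expR _.
  set P := _ `^ (2 * k%:R + a); set Q := _ `^ (- (2 * k%:R + a)).
  set U := t `^ (-1); set V := _ `^ (- a); set W := t `^ (sigma - 1).
  set X := _ `^ (2 * k)%:R; set T := t `^ _.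
  have E : U * V * W * P = X * Q * T.
    rewrite /P /Q /U /V /W /X /T.
    rewrite !powR_expR_ln ?mulr_gt0 ?invr_gt0//.
    rewrite !lnM ?posrE ?mulr_gt0 ?invr_gt0// !lnV ?posrE//.
    by rewrite -!expRD; congr expR; rewrite natrM; ring.
  transitivity (2^-1 * e * G^-1 * (U * V * W * P)); first by ring.
  by rewrite E; ring.
rewrite integral_nneseries//; last 2 first.
- move=> k; have : measurable_fun (`]0, +oo[ : set R) (fun t => A k * f k t).
    by apply: measurable_funM => //; exact: measurable_cst.
  by move=> /measurable_EFinP.
- by move=> k t _; rewrite -EFinM lee_fin mulr_ge0.
apply: eq_eseriesr => k _; rewrite ge0_integralZl_EFin//.
- by move=> t _; rewrite lee_fin.
- by apply/measurable_EFinP; exact: mf.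
Qed.

End bessel.

Section kernel_series.
Variable R : realType.
Implicit Types a b s x y sigma : R.

Lemma kernel_coef_gt0 a b k : -1 < a -> 0 < b -> 0 < kernel_coef a b k.
Proof.
move=> a1 b0; apply: divr_gt0.
  by apply: Gamma_gt0; rewrite ltr_wpDl// mulr_ge0.
apply: mulr_gt0; last exact: Gamma_shift_gt0.
by apply: mulr_gt0; [rewrite exprn_gt0|exact: fact_gt0R].
Qed.

Lemma potential_kernel_series a sigma x y :
  -1 < a -> 0 < sigma -> sigma < a + 1 -> 0 < x -> 0 < y ->
  let b := a + 1 - sigma in let S := x ^+ 2 + y ^+ 2 in
  (potential_kernel a sigma x y =
    ((Gamma sigma)^-1 * (2^-1 * 4 `^ (b - a) * S `^ (- b)))%:E *
    \sum_(k <oo) (kernel_coef a b k * ((2 * x * y / S) ^+ 2) ^+ k)%:E)%E.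
Proof.
move=> a1 s0 sa x0 y0 b S.
have b0 : 0 < b by rewrite subr_gt0.
have S0 : 0 < S by rewrite addr_gt0 ?exprn_gt0.
have u0 : 0 <= (2 * x * y / S) ^+ 2 by rewrite sqr_ge0.
rewrite potential_kernel_Tonelli// EFinM -muleA; congr (_ * _)%E.
rewrite -nneseriesZl; last first.
  move=> k _; rewrite lee_fin; apply: mulr_ge0; last exact: exprn_ge0.
  by apply: ltW; exact: kernel_coef_gt0.
apply: eq_eseriesr => k _.
have kb0 : 0 < 2 * k%:R + b by rewrite ltr_wpDl// mulr_ge0.
rewrite -/b -/S /inv_gamma_int integral_inv_gamma ?divr_gt0//.
rewrite -!EFinM; congr EFin; rewrite /kernel_coef.
have E : 4 `^ (- (2 * k%:R + a)) * (S / 4) `^ (- (2 * k%:R + b)) =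
    4 `^ (b - a) * S `^ (- b) * S^-1 ^+ (2 * k).
  rewrite -powR_mulrn ?invr_ge0 ?ltW//.
  rewrite !powR_expR_ln ?mulr_gt0 ?invr_gt0//.
  rewrite !lnM ?posrE ?mulr_gt0 ?invr_gt0// !lnV ?posrE//.
  by rewrite -!expRD; congr expR; rewrite natrM; ring.
have -> : ((2 * x * y / S) ^+ 2) ^+ k = 4 ^+ k * (x * y) ^+ (2 * k) * S^-1 ^+ (2 * k).
  rewrite !exprM -!exprMn; congr (_ ^+ _); by ring.
set G := Gamma (k%:R + a + 1); set H := Gamma (2 * k%:R + b).
have G0 : G != 0 by rewrite gt_eqF// Gamma_shift_gt0.
have f0 : k`!%:R != 0 :> R by rewrite gt_eqF// fact_gt0R.
have p0 : 4 ^+ k != 0 :> R by rewrite gt_eqF// exprn_gt0.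
transitivity (2^-1 * (x * y) ^+ (2 * k) * H / (k`!%:R * G) *
  (4 `^ (- (2 * k%:R + a)) * (S / 4) `^ (- (2 * k%:R + b)))).
  by ring.
rewrite E; set Q := S^-1 ^+ _; set P := (x * y) ^+ _.
by field; rewrite p0 G0 f0.
Qed.

(** The term k = 0 has exponent r = a + 1 - sigma <= 0, hence is infinite. *)
Lemma potential_kernel_oo a sigma x y :
  -1 < a -> a + 1 <= sigma -> 0 < x -> 0 < y -> potential_kernel a sigma x y = +oo%E.
Proof.
move=> a1 sa x0 y0.
have s0 : 0 < sigma by apply: lt_le_trans sa; lra.
rewrite potential_kernel_Tonelli//.
rewrite (@nneseries_pinfty _ _ _ 0%N)//.
- by rewrite gt0_muley// lte_fin invr_gt0 Gamma_gt0.
- move=> k _; rewrite mule_ge0//.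
    rewrite lee_fin divr_ge0 ?mulr_ge0 ?powR_ge0 ?exprn_ge0 ?mulr_ge0 ?(ltW x0) ?(ltW y0)//.
    by rewrite ltW// Gamma_shift_gt0.
  by apply: integral_ge0 => t _; rewrite lee_fin mulr_ge0 ?powR_ge0 ?expR_ge0.
rewrite /inv_gamma_int integral_inv_gamma_oo; last 2 first.
- by rewrite mulr0 add0r subr_le0.
- by rewrite divr_gt0// addr_gt0// exprn_gt0.
rewrite gt0_muley// lte_fin divr_gt0 ?mulr_gt0 ?powR_gt0 ?exprn_gt0 ?mulr_gt0//.
exact: Gamma_shift_gt0.
Qed.

Lemma kernel_coef_rec a b k : -1 < a -> 0 < b ->
  kernel_coef a b k.+1 * ((k%:R + 1) * (k%:R + a + 1)) =
  kernel_coef a b k * ((k%:R + b / 2) * (k%:R + (b + 1) / 2)).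
Proof.
move=> a1 b0; rewrite /kernel_coef.
have kb0 : 0 < 2 * k%:R + b by rewrite ltr_wpDl// mulr_ge0.
have ka0 : 0 < k%:R + a + 1 by rewrite -addrA ltr_wpDl//; lra.
have -> : 2 * k.+1%:R + b = 2 * k%:R + b + 1 + 1 :> R by rewrite -natr1; ring.
have -> : k.+1%:R + a + 1 = k%:R + a + 1 + 1 :> R by rewrite -natr1; ring.
rewrite (@GammaS _ (2 * k%:R + b + 1)) ?(addr_gt0 kb0 ltr01)//.
rewrite (@GammaS _ (2 * k%:R + b))// (@GammaS _ (k%:R + a + 1))//.
rewrite factS natrM exprS -[k.+1%:R]natr1.
have G0 : Gamma (k%:R + a + 1) != 0 by rewrite gt_eqF// Gamma_gt0.
have f0 : k`!%:R != 0 :> R by rewrite gt_eqF// fact_gt0R.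
have k1 : k%:R + 1 != 0 :> R by rewrite natr1.
have ka1 : k%:R + a + 1 != 0 by rewrite gt_eqF.
set H := Gamma _; set G := Gamma (k%:R + a + 1) in G0 *.
have p0 : 4 ^+ k != 0 :> R by rewrite gt_eqF// exprn_gt0.
by field; rewrite p0 G0 f0 k1 ka1.
Qed.

End kernel_series.

(** * Comparison of sequences with quadratic ratios *)

Section ratio.
Variable R : realType.

(** Since c + d = c' + d', the ratio r_(k+1) / r_k is at most 1 + M/(k+1)^2 for a
    constant M, so the infinite product converges.  Concretely, M/(k+1)^2 is at
    most 2M/(k+1) - 2M/(k+2), which makes r_k exp(2M/(k+1)) nonincreasing. *)
Lemma quad_ratio_bounded (r : nat -> R) (c d c' d' : R) :
  0 < c -> 0 < d -> c + d = c' + d' -> (forall k, 0 < r k) ->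
  (forall k, r k.+1 * ((k%:R + c) * (k%:R + d)) = r k * ((k%:R + c') * (k%:R + d'))) ->
  exists2 C : R, 0 < C & forall k, r k <= C.
Proof.
move=> c0 d0 cd r0 rec.
(* Chosen so that k + c and k + d are at least m (k + 1) for every k. *)
pose m := Num.min (Num.min c d) 1.
have m0 : 0 < m by rewrite !lt_min c0 d0 ltr01.
have [mc md m1] : [/\ m <= c, m <= d & m <= 1].
  by split; rewrite /m !ge_min lexx ?orbT.
pose M := `|c' * d' - c * d| / m ^+ 2.
have M0 : 0 <= M by rewrite divr_ge0// sqr_ge0.
pose e k := r k * expR (2 * M / (k%:R + 1)).
suff de k : e k.+1 <= e k.
  exists (r 0%N * expR (2 * M)); first by rewrite mulr_gt0 ?expR_gt0.
  move=> k; apply: (@le_trans _ _ (e k)).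
    rewrite /e ler_peMr ?(ltW (r0 k))// -expR0 ler_expR.
    by apply: divr_ge0; [exact: mulr_ge0|exact: addr_ge0].
  elim: k => [|k IH]; last exact: le_trans (de k) IH.
  by rewrite /e add0r divr1.
have k0 : 0 <= k%:R :> R by [].
set K : R := k%:R in k0 *.
have q0 : 0 < (K + c) * (K + d) by rewrite mulr_gt0// ltr_wpDl.
have key : r k.+1 <= r k * (1 + M / (K + 1) ^+ 2).
  rewrite -(ler_pM2r q0) rec -mulrA ler_pM2l//.
  have -> : (K + c') * (K + d') = (K + c) * (K + d) + (c' * d' - c * d).
    have -> : c' = c + d - d' by rewrite cd addrK.
    ring.
  rewrite [leRHS]mulrDl mul1r lerD2l.
  apply: (le_trans (ler_norm _)).
  rewrite -[leLHS](@divfK _ (m ^+ 2)) ?gt_eqF ?exprn_gt0// -/M.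
  rewrite -[leRHS]mulrA ler_wpM2l// -(ler_pM2l (_ : 0 < (K + 1) ^+ 2)); last first.
    by rewrite exprn_gt0// ltr_wpDl.
  rewrite mulrA mulfV ?gt_eqF ?exprn_gt0 ?ltr_wpDl// mul1r.
  have h1 : (K + 1) * m <= K + c by nra.
  have h2 : (K + 1) * m <= K + d by nra.
  have -> : (K + 1) ^+ 2 * m ^+ 2 = ((K + 1) * m) * ((K + 1) * m) by ring.
  by apply: ler_pM => //; rewrite mulr_ge0 ?addr_ge0// ltW.
rewrite /e -[k.+1%:R]natr1 -/K.
apply: (@le_trans _ _ (r k * expR (M / (K + 1) ^+ 2) * expR (2 * M / (K + 1 + 1)))).
  rewrite ler_wpM2r ?expR_ge0//; apply: (le_trans key).
  by rewrite ler_pM2l// expR_ge1Dx.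
rewrite -mulrA ler_pM2l// -expRD ler_expR.
have -> : 2 * M / (K + 1) = M * (2 / (K + 1)) by rewrite [RHS]mulrA [M * 2]mulrC.
have -> : 2 * M / (K + 1 + 1) = M * (2 / (K + 1 + 1)) by rewrite [RHS]mulrA [M * 2]mulrC.
rewrite -mulrDr ler_wpM2l//.
rewrite -subr_ge0.
have -> : 2 / (K + 1) - (((K + 1) ^+ 2)^-1 + 2 / (K + 1 + 1)) =
  K / ((K + 1) ^+ 2 * (K + 1 + 1)).
  have n1 : K + 1 != 0 by rewrite gt_eqF// ltr_wpDl.
  have n2 : K + 1 + 1 != 0 by rewrite gt_eqF// !ltr_wpDl// addr_ge0.
  field; by rewrite n1 n2.
by rewrite divr_ge0// mulr_ge0 ?sqr_ge0// !addr_ge0.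
Qed.

(** Boundedness of f/g and of g/f: the hypothesis is symmetric under exchanging the
    two sequences together with the two pairs of roots. *)
Lemma quad_ratio_comparable (f g : nat -> R) (c d c' d' : R) :
  0 < c -> 0 < d -> 0 < c' -> 0 < d' -> c + d = c' + d' ->
  (forall k, 0 < f k) -> (forall k, 0 < g k) ->
  (forall k, f k.+1 * g k * ((k%:R + c) * (k%:R + d)) =
             f k * g k.+1 * ((k%:R + c') * (k%:R + d'))) ->
  exists2 C : R, 0 < C & forall k, g k <= C * f k /\ f k <= C * g k.
Proof.
move=> c0 d0 c0' d0' cd f0 g0 rec.
have [C C0 hC] : exists2 C : R, 0 < C & forall k, f k / g k <= C.
  apply: (@quad_ratio_bounded _ c d c' d') => //.
    by move=> k; exact: divr_gt0.
  move=> k.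
  have [[fk gk] gk1] := (lt0r_neq0 (f0 k), lt0r_neq0 (g0 k), lt0r_neq0 (g0 k.+1)).
  apply: (mulIf gk); apply: (mulIf gk1).
  transitivity (f k.+1 * g k * ((k%:R + c) * (k%:R + d))); first by field.
  by rewrite rec; field.
have [D D0 hD] : exists2 D : R, 0 < D & forall k, g k / f k <= D.
  apply: (@quad_ratio_bounded _ c' d' c d) => //.
    by move=> k; exact: divr_gt0.
  move=> k.
  have [[gk fk] fk1] := (lt0r_neq0 (g0 k), lt0r_neq0 (f0 k), lt0r_neq0 (f0 k.+1)).
  apply: (mulIf fk); apply: (mulIf fk1).
  transitivity (f k * g k.+1 * ((k%:R + c') * (k%:R + d'))); first by field.
  by rewrite -rec; field.
exists (C + D); first by rewrite addr_gt0.
move=> k; split.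
  by rewrite -ler_pdivrMr// (le_trans (hD k))// lerDr ltW.
by rewrite -ler_pdivrMr// (le_trans (hC k))// lerDl ltW.
Qed.

End ratio.

(** * Size of the coefficients and generating series *)

Section generating.
Variable R : realType.
Implicit Types a b s u : R.

(** The factor k + 1 is common to both recurrences and cancels in the ratio of the
    two sequences, leaving two factors above and below; the relation between a, b
    and s is what equates the sums of the shifts. *)
Lemma kernel_coef_comparable_gamma a b s : -1 < a -> 0 < b -> 0 < s ->
  b + 2^-1 = a + 1 + s ->
  exists2 C : R, 0 < C & forall k : nat,
    Gamma (k%:R + s) / k`!%:R <= C * kernel_coef a b k /\
    kernel_coef a b k <= C * (Gamma (k%:R + s) / k`!%:R).
Proof.
move=> a1 b0 s0 bs.
have g0 (k : nat) : 0 < Gamma (k%:R + s) / k`!%:R.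
  by apply: divr_gt0; [apply: Gamma_gt0; rewrite ltr_wpDl|exact: fact_gt0R].
apply: (@quad_ratio_comparable _ _ _ (a + 1) s (b / 2) ((b + 1) / 2)) => //.
- by lra.
- by lra.
- by lra.
- by lra.
- by move=> k; exact: kernel_coef_gt0.
move=> k.
have ks0 : 0 < k%:R + s by rewrite ltr_wpDl.
have k1 : k%:R + 1 != 0 :> R by rewrite natr1.
have f0 := lt0r_neq0 (fact_gt0R R k).
have -> : Gamma (k.+1%:R + s) / k.+1`!%:R =
    Gamma (k%:R + s) / k`!%:R * ((k%:R + s) / (k%:R + 1)).
  have -> : k.+1%:R + s = k%:R + s + 1 by rewrite -natr1; ring.
  rewrite (@GammaS _ (k%:R + s))// factS natrM -[k.+1%:R]natr1.
  by set H := Gamma _; field; rewrite k1 f0.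
have rec := kernel_coef_rec k a1 b0.
set H := _ / k`!%:R.
set q := kernel_coef a b k in rec *; set q1 := kernel_coef a b k.+1 in rec *.
apply: (mulIf k1).
transitivity (q1 * ((k%:R + 1) * (k%:R + a + 1)) * H * (k%:R + s)); first by ring.
by rewrite rec; field; rewrite k1.
Qed.

(** The index is shifted by one because the comparison is with 1/k, which starts
    at k = 1; again one linear factor cancels in the ratio. *)
Lemma kernel_coef_comparable_harmonic a b : -1 < a -> 0 < b ->
  b = a + 2^-1 ->
  exists2 C : R, 0 < C & forall k : nat,
    (k.+1%:R)^-1 <= C * kernel_coef a b k.+1 /\
    kernel_coef a b k.+1 <= C * (k.+1%:R)^-1.
Proof.
move=> a1 b0 ba.
apply: (@quad_ratio_comparable _ (fun k => kernel_coef a b k.+1)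
  (fun k => (k.+1%:R)^-1) 1 (a + 2) (1 + b / 2) (1 + (b + 1) / 2)) => //.
- by lra.
- by lra.
- by lra.
- by lra.
- by move=> k; exact: kernel_coef_gt0.
move=> k; have rec := kernel_coef_rec k.+1 a1 b0.
set q := kernel_coef a b k.+1 in rec *; set q1 := kernel_coef a b k.+2 in rec *.
rewrite -![_.+1%:R]natr1 in rec *.
have k0 : 0 <= k%:R :> R by [].
set K : R := k%:R in k0 rec *.
have n1 : K + 1 != 0 by rewrite gt_eqF// ltr_wpDl.
have n2 : K + 1 + 1 != 0 by rewrite gt_eqF// ltr_wpDl// addr_ge0.
apply: (mulIf n2); apply: (mulIf n1).
transitivity (q1 * ((K + 1 + 1) * (K + 1 + a + 1)) * (K + 1)); first by field.
by rewrite rec; field.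
Qed.

(** Raabe's test.  For q = kernel_coef a b the difference k q_k - (k+1) q_(k+1)
    equals ((a + 1/2 - b) k - b(b+1)/4) / (k + a + 1) times q_k, hence is at least
    eta q_k for large k, and the partial sums telescope. *)
Lemma kernel_coef_summable a b : -1 < a -> 0 < b -> b < a + 2^-1 ->
  exists2 C : R, 0 < C & forall n : nat, \sum_(k < n) kernel_coef a b k <= C.
Proof.
move=> a1 b0 ba.
pose q := kernel_coef a b.
have q0 k : 0 < q k by exact: kernel_coef_gt0.
pose eta : R := (a + 2^-1 - b) / 2.
have eta0 : 0 < eta by rewrite divr_gt0// subr_gt0.
(* Beyond N, half of the linear coefficient a + 1/2 - b already absorbs the
   constant terms. *)
pose N := (Num.trunc ((b * (b + 1) / 4 + eta * (a + 1)) / eta)).+1.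
(* The telescoped quantity at N, an upper bound for all later ones. *)
pose T := eta * \sum_(k < N) q k + N%:R * q N.
have T0 : 0 < T.
  rewrite ltr_wpDl//; last by rewrite mulr_gt0.
  by rewrite mulr_ge0 ?(ltW eta0)// sumr_ge0// => k _; exact: ltW.
have step n : eta * \sum_(k < N + n) q k + (N + n)%:R * q (N + n)%N <= T.
  elim: n => [|n IH]; first by rewrite addn0.
  apply: le_trans IH; rewrite addnS big_ord_recr/= mulrDr -addrA lerD2l.
  set K := (N + n)%N.
  have rec := kernel_coef_rec K a1 b0.
  rewrite -/(q K) -/(q K.+1) in rec *.
  have NK : b * (b + 1) / 4 + eta * (a + 1) <= eta * K%:R.
    rewrite [leRHS]mulrC -ler_pdivrMr//; apply: (le_trans (ltW (truncnS_gt _))).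
    by rewrite ler_nat leq_addr.
  rewrite -[K.+1%:R]natr1; move: (K%:R) NK rec (ler0n R K) => k NK rec k0.
  have ka : 0 < k + a + 1 by lra.
  rewrite -(ler_pM2r ka).
  have -> : (eta * q K + (k + 1) * q K.+1) * (k + a + 1) =
     eta * q K * (k + a + 1) + q K.+1 * ((k + 1) * (k + a + 1)) by ring.
  rewrite rec.
  have -> : eta * q K * (k + a + 1) + q K * ((k + b / 2) * (k + (b + 1) / 2)) =
    q K * (eta * (k + a + 1) + (k + b / 2) * (k + (b + 1) / 2)) by ring.
  have -> : k * q K * (k + a + 1) = q K * (k * (k + a + 1)) by ring.
  rewrite ler_pM2l// -subr_ge0.
  have -> : k * (k + a + 1) - (eta * (k + a + 1) + (k + b / 2) * (k + (b + 1) / 2)) =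
    eta * k - (b * (b + 1) / 4 + eta * (a + 1)) by rewrite /eta; field.
  by rewrite subr_ge0.
exists (T / eta); first by rewrite divr_gt0.
move=> n; rewrite ler_pdivlMr// mulrC.
apply: le_trans (step n).
apply: (@le_trans _ _ (eta * \sum_(k < N + n) q k)); last first.
  by rewrite lerDl mulr_ge0// ltW.
rewrite ler_pM2l// addnC big_split_ord/= lerDl sumr_ge0// => k _; exact: ltW.
Qed.

(** The binomial series of (1 - u)^(-s): expand exp(ut) in Euler's integral of
    t^(s-1) exp(-t) exp(ut) and integrate term by term. *)
Lemma gamma_generating_series s u : 0 < s -> 0 <= u < 1 ->
  (\sum_(k <oo) (Gamma (k%:R + s) / k`!%:R * u ^+ k)%:E
   = (Gamma s * (1 - u) `^ (- s))%:E)%E.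
Proof.
move=> s0 /andP[u0 u1].
rewrite -integral_gamma_scale ?subr_gt0//.
transitivity (\int[mu]_(t in `]0%R, +oo[)
    (\sum_(k <oo) ((u ^+ k / k`!%:R)%:E * (t `^ (k%:R + s - 1) * expR (- t))%:E)))%E;
  last first.
  apply: eq_integral => t /[!inE]/=; rewrite in_itv/= andbT => t0.
  have -> : expR (- ((1 - u) * t)) = expR (- t) * expR (u * t).
    by rewrite -expRD; congr expR; ring.
  rewrite mulrA EFinM.
  have -> : (expR (u * t))%:E = (\sum_(k <oo) (exp_coeff (u * t) k)%:E)%E.
    by rewrite -EFin_lim_series//; exact: is_cvg_series_exp_coeff.
  rewrite -nneseriesZl; last first.
    by move=> k _; rewrite lee_fin exp_coeff_ge0// mulr_ge0// ltW.
  apply: eq_eseriesr => k _; rewrite -!EFinM /exp_coeff/=; congr EFin.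
  have -> : t `^ (k%:R + s - 1) = t `^ (s - 1) * t ^+ k.
    rewrite -powR_mulrn ?(ltW t0)// -powRD ?(gt_eqF t0) ?implybT//.
    by congr (_ `^ _); ring.
  by rewrite exprMn; ring.
have mf k : measurable_fun (`]0, +oo[ : set R) (fun t => t `^ (k%:R + s - 1) * expR (- t)).
  by rewrite gamma_integrand1; exact: measurable_gamma_integrand.
rewrite integral_nneseries//; last 2 first.
- move=> k; have : measurable_fun (`]0, +oo[ : set R)
     (fun t => u ^+ k / k`!%:R * (t `^ (k%:R + s - 1) * expR (- t))).
    by apply: measurable_funM => //; exact: measurable_cst.
  by move=> /measurable_EFinP.
- by move=> k t _; rewrite -EFinM lee_fin !mulr_ge0 ?invr_ge0 ?exprn_ge0 ?powR_ge0 ?expR_ge0.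
apply: eq_eseriesr => k _; rewrite ge0_integralZl_EFin//; last 3 first.
- by move=> t _; rewrite lee_fin mulr_ge0 ?powR_ge0 ?expR_ge0.
- by apply/measurable_EFinP; exact: mf.
- by rewrite divr_ge0// exprn_ge0.
rewrite -/(gamma_int (k%:R + s)) -GammaE ?ltr_wpDl// -EFinM; congr EFin.
by ring.
Qed.

(** The remainder after n terms has derivative t^n / (1 - t), so the mean value
    theorem bounds it by u^n / (1 - u). *)
Lemma log_series u : 0 <= u < 1 ->
  (\sum_(k <oo) (k.+1%:R^-1 * u ^+ k.+1)%:E = (- ln (1 - u))%:E)%E.
Proof.
move=> /andP[u0 u1].
pose f n (t : R) := - ln (1 - t) - \sum_(k < n) k.+1%:R^-1 * t ^+ k.+1.
have df n (t : R) : t < 1 -> is_derive t 1 (f n) (t ^+ n / (1 - t)).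
  move=> t1; have nt : 1 - t != 0 by rewrite subr_eq0 gt_eqF.
  elim: n => [|n IH].
    have -> : f 0%N = fun t => - ln (1 - t).
      by apply/funext => z; rewrite /f big_ord0 subr0.
    have h1 : is_derive t 1 (fun t : R => 1 - t) (-1).
      have h := is_deriveB (is_derive_cst (1 : R) t 1) (is_derive_id t 1).
      by apply: (is_derive_eq h); rewrite sub0r.
    have h2 : is_derive (1 - t) 1 (@ln R) (1 - t)^-1.
      by apply: is_derive1_ln; rewrite subr_gt0.
    have h := is_deriveN (@is_derive1_comp _ (@ln R) (fun t : R => 1 - t) t _ _ h2 h1).
    by apply: (is_derive_eq h); rewrite expr0 mulrN1 opprK mul1r.
  have -> : f n.+1 = f n - (n.+1%:R^-1 \*: (fun t : R => t ^+ n.+1)).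
    apply/funext => z; rewrite /f /= big_ord_recr/= opprD addrA.
    by [].
  have hX : is_derive t 1 (fun t : R => t ^+ n.+1) (n.+1%:R * t ^+ n).
    have h := is_deriveX n.+1 (is_derive_id t 1).
    rewrite exprfctE in h.
    by apply: (is_derive_eq h); rewrite /GRing.scale/= mulr1.
  have h := is_deriveB IH (is_deriveZ n.+1%:R^-1 hX).
  apply: (is_derive_eq h); rewrite /GRing.scale/= mulrA mulVf// mul1r exprS.
  by field.
have bound n : 0 <= f n u <= u ^+ n / (1 - u).
  have [c] : exists2 c, c \in `[0, u] & f n u - f n 0 = c ^+ n / (1 - c) * (u - 0).
    apply: (@MVT_segment _ (f n) (fun t => t ^+ n / (1 - t))) => //.
      move=> x; rewrite in_itv/= => /andP[_ xu]; apply: df; exact: lt_trans u1.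
    apply: continuous_in_subspaceT => x /[!inE]/=; rewrite in_itv/= => /andP[_ xu].
    apply: differentiable_continuous; apply/derivable1_diffP.
    exact: (@ex_derive _ _ _ _ _ _ _ (df n x (le_lt_trans xu u1))).
  rewrite in_itv/= => /andP[c0 cu].
  have -> : f n 0 = 0.
    rewrite /f subr0 ln1 oppr0 sub0r big1 ?oppr0// => k _.
    by rewrite expr0n/= mulr0.
  rewrite !subr0 => ->; have c1 : c < 1 by exact: le_lt_trans u1.
  apply/andP; split.
    by rewrite !mulr_ge0 ?exprn_ge0 ?invr_ge0 ?subr_ge0 ?(ltW c1).
  rewrite -[leRHS]mulr1 ler_pM ?divr_ge0 ?exprn_ge0 ?subr_ge0 ?(ltW c1) ?(ltW u1)//.
  rewrite ler_pM ?exprn_ge0 ?invr_ge0 ?subr_ge0 ?(ltW c1)//.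
    by rewrite lerXn2r.
  by rewrite lef_pV2 ?posrE ?subr_gt0// lerD2l lerN2.
have f_to0 : f n u @[n --> \oo] --> 0.
  apply: (@squeeze_cvgr _ _ _ _ (fun=> 0) (fun n => u ^+ n / (1 - u))).
  - exact: nearW.
  - exact: cvg_cst.
  - rewrite -[X in _ --> X](mul0r (1 - u)^-1); apply: cvgMl.
    by apply: cvg_expr; rewrite ger0_norm.
have cS : series (fun k : nat => k.+1%:R^-1 * u ^+ k.+1) n @[n --> \oo] --> - ln (1 - u).
  have -> : series (fun k : nat => k.+1%:R^-1 * u ^+ k.+1) = fun n => - ln (1 - u) - f n u.
    by apply/funext => n; rewrite /f opprB addrC subrK /series/= big_mkord.
  rewrite -[X in _ --> X]subr0; apply: cvgB => //; exact: cvg_cst.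
rewrite -EFin_lim_series; last by apply/cvg_ex; exists (- ln (1 - u)).
by rewrite (cvg_lim _ cS).
Qed.

End generating.

(** * Behaviour of the kernel series up to u = 1 *)

Section estimates.
Variable R : realType.
Implicit Types a b s u C : R.

Lemma le_scaled_nneseries (f g : nat -> R) C : 0 <= C ->
  (forall k, 0 <= f k) -> (forall k, 0 <= g k) -> (forall k, f k <= C * g k) ->
  (\sum_(k <oo) (f k)%:E <= C%:E * \sum_(k <oo) (g k)%:E)%E.
Proof.
move=> C0 f0 g0 fg; rewrite -nneseriesZl; last by move=> k _; rewrite lee_fin.
by apply: lee_nneseries => [k _ _|k _]; rewrite -?EFinM lee_fin.
Qed.

Definition kernel_series a b u : \bar R :=
  (\sum_(k <oo) (kernel_coef a b k * u ^+ k)%:E)%E.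

Lemma kernel_series_term_ge0 a b u k : -1 < a -> 0 < b -> 0 <= u ->
  0 <= kernel_coef a b k * u ^+ k.
Proof.
by move=> a1 b0 u0; rewrite mulr_ge0 ?exprn_ge0//; apply: ltW; exact: kernel_coef_gt0.
Qed.

Lemma kernel_series_le a b u v : -1 < a -> 0 < b -> 0 <= u -> u <= v ->
  (kernel_series a b u <= kernel_series a b v)%E.
Proof.
move=> a1 b0 u0 uv; apply: lee_nneseries => [k _ _|k _]; rewrite lee_fin.
  exact: kernel_series_term_ge0.
apply: ler_wpM2l; first by apply: ltW; exact: kernel_coef_gt0.
by rewrite lerXn2r ?nnegrE// (le_trans u0).
Qed.

(** The lower bound is multiplied out by C, so that it can be scaled by extended
    reals. *)
Definition within_factor C (X : \bar R) (Y : R) : Prop :=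
  (Y%:E <= C%:E * X)%E /\ (X <= (C * Y)%:E)%E.

Lemma kernel_series_lt_half a b s : -1 < a -> 0 < b -> 0 < s ->
  b + 2^-1 = a + 1 + s ->
  exists2 C : R, 0 < C & forall u, 0 <= u < 1 ->
    within_factor C (kernel_series a b u) ((1 - u) `^ (- s)).
Proof.
move=> a1 b0 s0 bs.
have [C C0 hC] := kernel_coef_comparable_gamma a1 b0 s0 bs.
have G0 : 0 < Gamma s by exact: Gamma_gt0.
have g0 (k : nat) : 0 <= Gamma (k%:R + s) / k`!%:R.
  by apply: divr_ge0 => //; apply: ltW; apply: Gamma_gt0; rewrite ltr_wpDl.
exists (C / Gamma s + C * Gamma s); first by rewrite addr_gt0 ?divr_gt0 ?mulr_gt0.
move=> u /andP[u0 u1].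
have u01 : 0 <= u < 1 by rewrite u0 u1.
have P0 : 0 <= (1 - u) `^ (- s) by exact: powR_ge0.
have F0 : (0 <= kernel_series a b u)%E.
  by apply: nneseries_ge0 => k _ _; rewrite lee_fin kernel_series_term_ge0.
split.
  apply: (@le_trans _ _ ((C / Gamma s)%:E * kernel_series a b u)%E); last first.
    by rewrite lee_wpmul2r// lee_fin lerDl mulr_ge0 ?ltW.
  have -> : (1 - u) `^ (- s) = (Gamma s)^-1 * (Gamma s * (1 - u) `^ (- s)).
    by rewrite mulrA mulVf ?mul1r// gt_eqF.
  rewrite [C / _]mulrC !EFinM -muleA; apply: lee_wpmul2l.
    by rewrite lee_fin invr_ge0 ltW.
  rewrite -EFinM -gamma_generating_series//.
  apply: le_scaled_nneseries => //; first exact: ltW.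
  - by move=> k; rewrite mulr_ge0 ?exprn_ge0.
  - by move=> k; exact: kernel_series_term_ge0.
  - by move=> k; rewrite mulrA ler_wpM2r ?exprn_ge0//; case: (hC k).
apply: (@le_trans _ _ (C%:E * (Gamma s * (1 - u) `^ (- s))%:E)%E); last first.
  rewrite -EFinM lee_fin mulrA ler_wpM2r// lerDr divr_ge0 ?ltW//.
rewrite -gamma_generating_series//.
apply: le_scaled_nneseries => //; first exact: ltW.
- by move=> k; exact: kernel_series_term_ge0.
- by move=> k; rewrite mulr_ge0 ?exprn_ge0.
- by move=> k; rewrite mulrA ler_wpM2r ?exprn_ge0//; case: (hC k).
Qed.

Lemma kernel_series_half a b : -1 < a -> 0 < b -> b = a + 2^-1 ->
  exists2 C : R, 0 < C & forall u, 0 <= u < 1 ->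
    within_factor C (kernel_series a b u) (1 - ln (1 - u)).
Proof.
move=> a1 b0 ba.
have [C C0 hC] := kernel_coef_comparable_harmonic a1 b0 ba.
pose q0 := kernel_coef a b 0.
have q00 : 0 < q0 by exact: kernel_coef_gt0.
exists (q0^-1 + C + q0 + C); first by rewrite !addr_gt0 ?invr_gt0.
move=> u /andP[u0 u1].
have u01 : 0 <= u < 1 by rewrite u0 u1.
have L0 : 0 <= - ln (1 - u) by rewrite oppr_ge0 ln_le0// gerBl.
pose T : \bar R := (\sum_(k <oo) (kernel_coef a b k.+1 * u ^+ k.+1)%:E)%E.
have T0 : (0 <= T)%E.
  by apply: nneseries_ge0 => k _ _; rewrite lee_fin kernel_series_term_ge0.
have E : kernel_series a b u = (q0%:E + T)%E.
  rewrite /kernel_series nneseries_recl//; last first.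
    by move=> k _; rewrite lee_fin kernel_series_term_ge0.
  rewrite expr0 mulr1; congr (_ + _)%E.
  rewrite -(@nneseries_addn _ (fun k => (kernel_coef a b k * u ^+ k)%:E) 1); last first.
    by move=> k; rewrite lee_fin kernel_series_term_ge0.
  by apply: eq_eseriesr => k _; rewrite addn1.
have g0 (k : nat) : 0 <= k.+1%:R^-1 * u ^+ k.+1 by rewrite mulr_ge0 ?exprn_ge0 ?invr_ge0.
have hT1 : ((- ln (1 - u))%:E <= C%:E * T)%E.
  rewrite -log_series//; apply: le_scaled_nneseries => //; first exact: ltW.
  - by move=> k; exact: kernel_series_term_ge0.
  - by move=> k; rewrite mulrA ler_wpM2r ?exprn_ge0//; case: (hC k).
have hT2 : (T <= (C * - ln (1 - u))%:E)%E.
  rewrite EFinM -log_series//; apply: le_scaled_nneseries => //; first exact: ltW.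
  - by move=> k; exact: kernel_series_term_ge0.
  - by move=> k; rewrite mulrA ler_wpM2r ?exprn_ge0//; case: (hC k).
rewrite E; split.
  rewrite EFinD ge0_muleDr// ?lee_fin ?(ltW q00)//.
  apply: leeD.
    rewrite -EFinM lee_fin -[leLHS](mulVf (lt0r_neq0 q00)) ler_pM2r//.
    by rewrite -!addrA lerDl !addr_ge0// ltW.
  apply: (le_trans hT1); rewrite lee_wpmul2r// lee_fin.
  by rewrite lerDr !addr_ge0 ?invr_ge0 ?ltW.
apply: (@le_trans _ _ (q0%:E + (C * - ln (1 - u))%:E)%E); first exact: leeD2l.
rewrite -EFinD lee_fin mulrDr mulr1 lerD//.
  by rewrite addrAC lerDr !addr_ge0 ?invr_ge0 ?ltW.
rewrite ler_wpM2r//; by rewrite lerDr !addr_ge0 ?invr_ge0 ?ltW.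
Qed.

Lemma kernel_series_gt_half a b : -1 < a -> 0 < b -> b < a + 2^-1 ->
  exists2 C : R, 0 < C & forall u, 0 <= u <= 1 ->
    within_factor C (kernel_series a b u) 1.
Proof.
move=> a1 b0 ba.
have [C C0 hC] := kernel_coef_summable a1 b0 ba.
pose q0 := kernel_coef a b 0.
have q00 : 0 < q0 by exact: kernel_coef_gt0.
exists (q0^-1 + C); first by rewrite addr_gt0 ?invr_gt0.
move=> u /andP[u0 u1].
have t0 k : (0 <= (kernel_coef a b k * u ^+ k)%:E)%E.
  by rewrite lee_fin kernel_series_term_ge0.
split.
  apply: (@le_trans _ _ ((q0^-1 + C)%:E * q0%:E)%E).
    rewrite -EFinM lee_fin mulrDl mulVf ?gt_eqF// lerDl mulr_ge0// ltW//.
  apply: lee_wpmul2l; first by rewrite lee_fin addr_ge0 ?invr_ge0 ?ltW.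
  rewrite /kernel_series nneseries_recl// expr0 mulr1 leeDl//.
  by apply: nneseries_ge0 => k _ _.
rewrite mulr1; apply: lime_le; first by apply: is_cvg_nneseries => k _ _.
apply: nearW => n; rewrite sumEFin lee_fin big_mkord.
apply: (@le_trans _ _ (\sum_(k < n) kernel_coef a b k)).
  apply: ler_sum => k _; rewrite ler_piMr ?exprn_ile1//.
  by apply: ltW; exact: kernel_coef_gt0.
by apply: (le_trans (hC n)); rewrite lerDr invr_ge0 ltW.
Qed.

(** The series is nondecreasing in u, so its value at 1 dominates every lower bound
    g(u) with u < 1. *)
Lemma kernel_series_one_oo a b (g : R -> R) C : -1 < a -> 0 < b -> 0 < C ->
  (forall u, 0 <= u < 1 -> ((g u)%:E <= C%:E * kernel_series a b u)%E) ->
  (forall A : R, 0 < A -> exists2 u, 0 <= u < 1 & A <= g u) ->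
  kernel_series a b 1 = +oo%E.
Proof.
move=> a1 b0 C0 hg unb; apply/eqyP => A A0.
have [u /andP[u0 u1] Agu] := unb (C * A) (mulr_gt0 C0 A0).
apply: (@le_trans _ _ (kernel_series a b u)); last first.
  by apply: kernel_series_le => //; exact: ltW.
rewrite -(@lee_pmul2l _ C%:E)//.
apply: le_trans (hg u _); last by rewrite u0 u1.
by rewrite -EFinM lee_fin.
Qed.

Lemma kernel_series_one_lt_half a b s : -1 < a -> 0 < b -> 0 < s ->
  b + 2^-1 = a + 1 + s -> kernel_series a b 1 = +oo%E.
Proof.
move=> a1 b0 s0 bs.
have [C C0 hC] := kernel_series_lt_half a1 b0 s0 bs.
apply: (kernel_series_one_oo a1 b0 C0 (fun u hu => (hC u hu).1)) => A A0.
have B1 : 1 <= 1 + A by rewrite lerDl ltW.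
have B0 : 0 < 1 + A by exact: lt_le_trans B1.
(* Solves (1 - u)^(-s) = 1 + A. *)
exists (1 - (1 + A) `^ (- s^-1)).
  rewrite subr_ge0 ltrBlDr ltrDl powR_gt0// andbT -[leRHS](powRr0 (1 + A)).
  by rewrite ler_powR// oppr_le0 invr_ge0 ltW.
rewrite subKr -powRrM mulrNN mulVf ?gt_eqF// powRr1 ?(ltW B0)//.
by rewrite lerDr.
Qed.

Lemma kernel_series_one_half a b : -1 < a -> 0 < b -> b = a + 2^-1 ->
  kernel_series a b 1 = +oo%E.
Proof.
move=> a1 b0 ba.
have [C C0 hC] := kernel_series_half a1 b0 ba.
apply: (kernel_series_one_oo a1 b0 C0 (fun u hu => (hC u hu).1)) => A A0.
exists (1 - expR (- A)).
  by rewrite subr_ge0 expR_le1 oppr_le0 (ltW A0)/= ltrBlDr ltrDl expR_gt0.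
by rewrite subKr expRK opprK lerDr.
Qed.

End estimates.

(** * Geometry of the two variables *)

Section geometry.
Variable R : realType.
Implicit Types x y p : R.

Lemma ln_sum_sqr x y : 0 < x -> 0 < y ->
  2 * ln (x + y) - ln 2 <= ln (x ^+ 2 + y ^+ 2) <= 2 * ln (x + y).
Proof.
move=> x0 y0.
have P0 : 0 < x + y by rewrite addr_gt0.
have S0 : 0 < x ^+ 2 + y ^+ 2 by rewrite addr_gt0 ?exprn_gt0.
have -> : 2 * ln (x + y) = ln ((x + y) ^+ 2) by rewrite lnXn// mulr_natl.
rewrite -ln_div ?posrE ?exprn_gt0// !ler_ln ?posrE ?divr_gt0 ?exprn_gt0//.
apply/andP; split; rewrite -subr_ge0.
  have -> : x ^+ 2 + y ^+ 2 - (x + y) ^+ 2 / 2 = (x - y) ^+ 2 / 2 by field.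
  by rewrite divr_ge0// sqr_ge0.
have -> : (x + y) ^+ 2 - (x ^+ 2 + y ^+ 2) = 2 * (x * y) by ring.
by rewrite !mulr_ge0// ltW.
Qed.

Lemma powR_sum_sqr_comparable p : exists2 M : R, 0 < M &
  forall x y, 0 < x -> 0 < y ->
    (x + y) `^ (2 * p) <= M * (x ^+ 2 + y ^+ 2) `^ p /\
    (x ^+ 2 + y ^+ 2) `^ p <= M * (x + y) `^ (2 * p).
Proof.
exists (expR (`|p| * ln 2)); first exact: expR_gt0.
move=> x y x0 y0.
have P0 : 0 < x + y by rewrite addr_gt0.
have S0 : 0 < x ^+ 2 + y ^+ 2 by rewrite addr_gt0 ?exprn_gt0.
have /andP[h1 h2] := ln_sum_sqr x0 y0.
set l := ln (x ^+ 2 + y ^+ 2) - 2 * ln (x + y).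
have hl : `|p * l| <= `|p| * ln 2.
  rewrite normrM ler_wpM2l// ler_norml.
  have l2 : 0 <= ln 2 :> R by rewrite ln_ge0// ler1n.
  by rewrite /l; apply/andP; split; lra.
move: hl; rewrite ler_norml => /andP[h3 h4].
rewrite !powR_expR_ln// -!expRD !ler_expR.
have E : p * ln (x ^+ 2 + y ^+ 2) = p * l + 2 * p * ln (x + y) by rewrite /l; ring.
by rewrite E; split; lra.
Qed.

(** The singular point u = 1 of the kernel series corresponds to the diagonal, and
    the distance to it is measured by |x - y| relative to x + y. *)
Lemma one_sub_sqr_ratio x y : 0 < x -> 0 < y ->
  1 - (2 * x * y / (x ^+ 2 + y ^+ 2)) ^+ 2 =
  (`|x - y| * (x + y) / (x ^+ 2 + y ^+ 2)) ^+ 2.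
Proof.
move=> x0 y0; rewrite !exprMn real_normK ?num_real//.
by field; rewrite gt_eqF// addr_gt0 ?exprn_gt0.
Qed.

Lemma sqr_ratio_itv x y : 0 < x -> 0 < y ->
  0 <= (2 * x * y / (x ^+ 2 + y ^+ 2)) ^+ 2 <= 1.
Proof.
by move=> x0 y0; rewrite sqr_ge0/= -subr_ge0 one_sub_sqr_ratio// sqr_ge0.
Qed.

Lemma sqr_ratio_lt1 x y : 0 < x -> 0 < y -> x != y ->
  0 <= (2 * x * y / (x ^+ 2 + y ^+ 2)) ^+ 2 < 1.
Proof.
move=> x0 y0 xy; rewrite sqr_ge0/= -subr_gt0 one_sub_sqr_ratio//.
by rewrite exprn_gt0// divr_gt0 ?mulr_gt0 ?normr_gt0 ?subr_eq0 ?addr_gt0 ?exprn_gt0.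
Qed.

Lemma sqr_ratio_diag x : 0 < x -> (2 * x * x / (x ^+ 2 + x ^+ 2)) ^+ 2 = 1.
Proof.
by move=> x0; field; rewrite gt_eqF// addr_gt0 ?exprn_gt0.
Qed.

Lemma ln_one_sub_sqr_ratio x y : 0 < x -> 0 < y -> x != y ->
  ln (1 - (2 * x * y / (x ^+ 2 + y ^+ 2)) ^+ 2) =
  2 * (ln `|x - y| + ln (x + y) - ln (x ^+ 2 + y ^+ 2)).
Proof.
move=> x0 y0 xy; rewrite one_sub_sqr_ratio//.
have D0 : 0 < `|x - y| by rewrite normr_gt0 subr_eq0.
have P0 : 0 < x + y by rewrite addr_gt0.
have S0 : 0 < x ^+ 2 + y ^+ 2 by rewrite addr_gt0 ?exprn_gt0.
by rewrite lnXn ?divr_gt0 ?mulr_gt0// ln_div ?posrE ?mulr_gt0// lnM ?posrE// mulr_natl.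
Qed.

(** Y equals 1 + 2 L - 2 ln 2 - 2 e, where e = 2 ln(x + y) - ln(x^2 + y^2) lies
    between 0 and ln 2.  The additive constants are absorbed using
    Y >= 1 and L >= ln 2. *)
Lemma log_factor_comparable : exists2 M : R, 0 < M &
  forall x y, 0 < x -> 0 < y -> x != y ->
    let Y := 1 - ln (1 - (2 * x * y / (x ^+ 2 + y ^+ 2)) ^+ 2) in
    let L := ln (2 * (x + y) / `|x - y|) in
    L <= M * Y /\ Y <= M * L.
Proof.
have l2 : 0 < ln 2 :> R by rewrite ln_gt0// ltr1n.
exists ((ln 2)^-1 + 2 + 2 * ln 2).
  by rewrite !addr_gt0 ?invr_gt0 ?mulr_gt0.
move=> x y x0 y0 xy Y L.
have D0 : 0 < `|x - y| by rewrite normr_gt0 subr_eq0.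
have P0 : 0 < x + y by rewrite addr_gt0.
have /andP[h1 h2] := ln_sum_sqr x0 y0.
have /andP[u0 u1] := sqr_ratio_lt1 x0 y0 xy.
have Y1 : 1 <= Y by rewrite lerDl oppr_ge0 ln_le0// gerBl.
have YE : Y = 1 - 2 * (ln `|x - y| + ln (x + y) - ln (x ^+ 2 + y ^+ 2)).
  by rewrite /Y ln_one_sub_sqr_ratio.
have LE : L = ln 2 + ln (x + y) - ln `|x - y|.
  by rewrite /L ln_div ?posrE ?mulr_gt0// lnM ?posrE.
have DP : ln `|x - y| <= ln (x + y).
  rewrite ler_ln ?posrE// ler_norml; apply/andP; split; lra.
have L2 : ln 2 <= L by rewrite LE; lra.
have i2 : 0 <= (ln 2)^-1 :> R by rewrite invr_ge0 ltW.
split.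
  have h : L <= (2^-1 + 2 * ln 2) * Y.
    rewrite mulrDl; have : 2 * ln 2 <= 2 * ln 2 * Y by rewrite ler_peMr// mulr_ge0// ltW.
    rewrite LE; lra.
  apply: (le_trans h); rewrite ler_wpM2r ?(le_trans ler01 Y1)//.
  lra.
have h : Y <= ((ln 2)^-1 + 2) * L.
  rewrite mulrDl; have : 1 <= (ln 2)^-1 * L by rewrite mulrC ler_pdivlMr// mul1r.
  rewrite LE; lra.
apply: (le_trans h); rewrite ler_wpM2r ?(le_trans (ltW l2) L2)// lerDl.
by rewrite mulr_ge0// ltW.
Qed.

End geometry.

(** * Two-sided estimates of the kernel *)

Lemma scale_factor_gt0 (R : realType) (c C M : R) : 0 < c -> 0 < C -> 0 < M ->
  0 < c * C * M + M * C / c.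
Proof. by move=> c0 C0 M0; rewrite addr_gt0 ?divr_gt0 ?mulr_gt0. Qed.

Lemma within_factor_scale (R : realType) (c q C M Y T : R) (F : \bar R) :
  0 < c -> 0 < q -> 0 < C -> 0 < M -> 0 <= T -> (0 <= F)%E ->
  within_factor C F Y -> T <= M * (q * Y) -> q * Y <= M * T ->
  within_factor (c * C * M + M * C / c) ((c * q)%:E * F)%E T.
Proof.
move=> c0 q0 C0 M0 T0 F0 [h1 h2] t1 t2; split.
  apply: (@le_trans _ _ ((M * C / c)%:E * ((c * q)%:E * F))%E); last first.
    apply: lee_wpmul2r.
      by rewrite mule_ge0// lee_fin mulr_ge0// ltW.
    by rewrite lee_fin lerDr !mulr_ge0// ltW.
  rewrite muleA -EFinM.
  have -> : M * C / c * (c * q) = M * q * C by field; rewrite gt_eqF.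
  apply: (@le_trans _ _ ((M * q)%:E * Y%:E)%E).
    by rewrite -EFinM lee_fin -mulrA.
  by rewrite (EFinM (M * q) C) -[leRHS]muleA lee_wpmul2l// lee_fin mulr_ge0// ltW.
apply: (@le_trans _ _ ((c * q)%:E * (C * Y)%:E)%E).
  by rewrite lee_wpmul2l// lee_fin mulr_ge0// ltW.
rewrite -EFinM lee_fin.
have -> : c * q * (C * Y) = c * C * (q * Y) by ring.
apply: (@le_trans _ _ (c * C * (M * T))).
  by rewrite ler_wpM2l// mulr_ge0// ltW.
by rewrite mulrA ler_wpM2r// lerDl divr_ge0 ?mulr_ge0// ltW.
Qed.

Section kernel_estimates.
Variable R : realType.
Variables a sigma : R.
Hypotheses (a1 : -1 < a) (s0 : 0 < sigma) (sa : sigma < a + 1).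
Implicit Types x y : R.

Let b := a + 1 - sigma.
Let c := (Gamma sigma)^-1 * (2^-1 * 4 `^ (b - a)).
Let S x y := x ^+ 2 + y ^+ 2.
Let u x y := (2 * x * y / S x y) ^+ 2.

Let b0 : 0 < b. Proof. by rewrite subr_gt0. Qed.

Let c0 : 0 < c.
Proof. by rewrite !mulr_gt0 ?invr_gt0 ?powR_gt0// Gamma_gt0. Qed.

Let KE x y : 0 < x -> 0 < y ->
  potential_kernel a sigma x y = ((c * S x y `^ (- b))%:E * kernel_series a b (u x y))%E.
Proof.
move=> x0 y0; rewrite potential_kernel_series// /c.
by congr (_%:E * _)%E; rewrite -!mulrA.
Qed.

Let S0 x y : 0 < x -> 0 < y -> 0 < S x y.
Proof. by move=> x0 y0; rewrite addr_gt0 ?exprn_gt0. Qed.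

Let F0 x y : (0 <= kernel_series a b (u x y))%E.
Proof.
apply: nneseries_ge0 => k _ _; rewrite lee_fin.
by apply: kernel_series_term_ge0 => //; exact: sqr_ge0.
Qed.

(** With s = 1/2 - sigma, (1 - u)^(-s) contributes |x - y|^(2 sigma - 1) exactly, and
    the remaining powers of x^2 + y^2 are traded for powers of x + y. *)
Lemma potential_kernel_lt_half : sigma < 2^-1 ->
  exists2 C : R, 0 < C & forall x y, 0 < x -> 0 < y -> x != y ->
    within_factor C (potential_kernel a sigma x y)
      ((x + y) `^ (- 2 * a - 1) * `|x - y| `^ (2 * sigma - 1)).
Proof.
move=> sh; pose s := 2^-1 - sigma.
have s_gt0 : 0 < s by rewrite subr_gt0.
have bs : b + 2^-1 = a + 1 + s by rewrite /b /s; ring.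
have [C C0 hC] := kernel_series_lt_half a1 b0 s_gt0 bs.
(* The net exponent of x^2 + y^2: -b from the prefactor and 2s from (1 - u)^(-s). *)
pose p := - a - sigma.
have [M M0 hM] := powR_sum_sqr_comparable p.
exists (c * C * M + M * C / c); first exact: scale_factor_gt0.
move=> x y x0 y0 xy; rewrite KE//.
have Sp := S0 x0 y0.
have D0 : 0 < `|x - y| by rewrite normr_gt0 subr_eq0.
have P0 : 0 < x + y by rewrite addr_gt0.
have u01 := sqr_ratio_lt1 x0 y0 xy.
have [h1 h2] := hM x y x0 y0.
pose W := (x + y) `^ (- 2 * s) * `|x - y| `^ (- 2 * s).
have W0 : 0 <= W by rewrite mulr_ge0 ?powR_ge0.
have TE : (x + y) `^ (- 2 * a - 1) * `|x - y| `^ (2 * sigma - 1) = (x + y) `^ (2 * p) * W.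
  rewrite /W mulrA !powR_expR_ln// -!expRD; congr expR; rewrite /s /p.
  by field.
have YE : S x y `^ (- b) * (1 - u x y) `^ (- s) = S x y `^ p * W.
  rewrite /W !powR_expR_ln//; last by rewrite subr_gt0; case/andP: u01.
  rewrite ln_one_sub_sqr_ratio// -!expRD; congr expR; rewrite /s /p /b /S.
  by field.
apply: (within_factor_scale (Y := (1 - u x y) `^ (- s))) => //.
- exact: powR_gt0.
- by rewrite TE mulr_ge0// powR_ge0.
- exact: hC.
- by rewrite TE YE mulrA ler_wpM2r.
- by rewrite TE YE mulrA ler_wpM2r.
Qed.

Lemma potential_kernel_half : sigma = 2^-1 ->
  exists2 C : R, 0 < C & forall x y, 0 < x -> 0 < y -> x != y ->
    within_factor C (potential_kernel a sigma x y)
      ((x + y) `^ (- 2 * a - 1) * ln (2 * (x + y) / `|x - y|)).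
Proof.
move=> sh; have ba : b = a + 2^-1 by rewrite /b sh; field.
have [C C0 hC] := kernel_series_half a1 b0 ba.
have [M M0 hM] := powR_sum_sqr_comparable (- b).
have [N N0 hN] := log_factor_comparable R.
exists (c * C * (M * N) + (M * N) * C / c);
  first exact: scale_factor_gt0 (mulr_gt0 M0 N0).
move=> x y x0 y0 xy; rewrite KE//.
have Sp := S0 x0 y0.
have D0 : 0 < `|x - y| by rewrite normr_gt0 subr_eq0.
have P0 : 0 < x + y by rewrite addr_gt0.
have u01 := sqr_ratio_lt1 x0 y0 xy.
have [h1 h2] := hM x y x0 y0.
have [h3 h4] := hN x y x0 y0 xy.
have -> : - 2 * a - 1 = 2 * - b by rewrite ba; field.
set Y := 1 - _ in h3 h4; set L := ln (2 * _ / _) in h3 h4 *.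
have Y0 : 0 <= Y.
  have /andP[v0 v1] := u01.
  by rewrite /Y subr_ge0 (le_trans (ln_le0 _))// gerBl.
have L0 : 0 <= L by rewrite -(pmulr_rge0 _ N0) (le_trans Y0).
apply: (within_factor_scale (Y := Y)) => //.
- exact: powR_gt0.
- exact: mulr_gt0.
- by rewrite mulr_ge0// powR_ge0.
- exact: hC.
- by rewrite mulrACA ler_pM ?powR_ge0.
- by rewrite mulrACA ler_pM ?powR_ge0.
Qed.

Lemma potential_kernel_gt_half : 2^-1 < sigma ->
  exists2 C : R, 0 < C & forall x y, 0 < x -> 0 < y ->
    within_factor C (potential_kernel a sigma x y)
      ((x + y) `^ (- 2 * a - 1) * (x + y) `^ (2 * sigma - 1)).
Proof.
move=> sh; have ba : b < a + 2^-1 by rewrite /b; lra.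
have [C C0 hC] := kernel_series_gt_half a1 b0 ba.
have [M M0 hM] := powR_sum_sqr_comparable (- b).
exists (c * C * M + M * C / c); first exact: scale_factor_gt0.
move=> x y x0 y0; rewrite KE//.
have Sp := S0 x0 y0.
have P0 : 0 < x + y by rewrite addr_gt0.
have [h1 h2] := hM x y x0 y0.
have TE : (x + y) `^ (- 2 * a - 1) * (x + y) `^ (2 * sigma - 1) = (x + y) `^ (2 * - b).
  by rewrite !powR_expR_ln// -!expRD; congr expR; rewrite /b; ring.
apply: (within_factor_scale (Y := 1)) => //.
- exact: powR_gt0.
- by rewrite TE powR_ge0.
- exact: hC (sqr_ratio_itv x0 y0).
- by rewrite TE mulr1.
- by rewrite TE mulr1.
Qed.

Lemma potential_kernel_diag x : 0 < x -> sigma <= 2^-1 ->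
  potential_kernel a sigma x x = +oo%E.
Proof.
move=> x0 sh; rewrite KE// /u /S sqr_ratio_diag//.
have -> : kernel_series a b 1 = +oo%E.
  move: sh; rewrite le_eqVlt => /predU1P[sh|sh].
    by apply: kernel_series_one_half => //; rewrite /b sh; field.
  apply: (@kernel_series_one_lt_half _ a b (2^-1 - sigma)) => //.
    by rewrite subr_gt0.
  by rewrite /b; ring.
by rewrite gt0_muley// lte_fin mulr_gt0// powR_gt0// S0.
Qed.

End kernel_estimates.

Lemma within_factor_bounds (R : realType) (C : R) (X : \bar R) (Y : R) :
  0 < C -> within_factor C X Y ->
  (C^-1%:E * Y%:E <= X)%E /\ (X <= C%:E * Y%:E)%E.
Proof. by move=> C0 [h1 h2]; rewrite lee_pdivrMl. Qed.

Unset Implicit Arguments.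

Theorem theorem2p1 (R : realType) (alpha sigma : R) (halpha : -1 < alpha) :
  (0 < sigma -> sigma < alpha + 1 ->
    comparable_on [set p : R * R | 0 < p.1 /\ 0 < p.2]
      (fun p => potential_kernel alpha sigma p.1 p.2)
      (fun p => let: (x, y) := p in
        (((x + y) `^ (- 2 * alpha - 1))%:E *
         (if (sigma < 2^-1)%R then epow `|x - y|%R (2 * sigma - 1)%R
          else if (sigma == 2^-1)%R then lne ((2 * (x + y))%:E / `|x - y|%:E)
          else ((x + y) `^ (2 * sigma - 1))%:E))%E)) /\
  (alpha + 1 <= sigma ->
    forall x y : R, 0 < x -> 0 < y -> potential_kernel alpha sigma x y = +oo%E).
Proof.
split=> [s0 sa|sa x y x0 y0]; last exact: potential_kernel_oo.
case: ltgtP => sh.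
- have [C C0 hC] := potential_kernel_lt_half halpha s0 sa sh.
  exists C => // -[x y] /= [x0 y0].
  have [->|xy] := eqVneq x y.
    rewrite potential_kernel_diag ?(ltW sh)// subrr normr0 /epow eqxx/=.
    have -> : 2 * sigma - 1 < 0 by lra.
    by rewrite gt0_muley ?lte_fin ?powR_gt0 ?addr_gt0// !gt0_muley ?lte_fin ?invr_gt0.
  rewrite /epow normr_eq0 subr_eq0 (negbTE xy)/= -EFinM.
  exact/within_factor_bounds/hC.
- have [C C0 hC] := potential_kernel_gt_half halpha s0 sa sh.
  exists C => // -[x y] /= [x0 y0]; rewrite -EFinM.
  exact/within_factor_bounds/hC.
- have [C C0 hC] := potential_kernel_half halpha s0 sa sh.
  exists C => // -[x y] /= [x0 y0].
  have P0 : 0 < x + y by rewrite addr_gt0.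
  have [exy|xy] := eqVneq x y.
    rewrite exy (potential_kernel_diag halpha s0 sa y0) ?sh// subrr normr0 inve0.
    rewrite gt0_muley; last by rewrite lte_fin mulr_gt0// addr_gt0.
    by rewrite /= gt0_muley ?lte_fin ?powR_gt0 ?addr_gt0// !gt0_muley ?lte_fin ?invr_gt0.
  have D0 : 0 < `|x - y| by rewrite normr_gt0 subr_eq0.
  rewrite inver gt_eqF// -EFinM lne_EFin ?divr_gt0 ?mulr_gt0// -EFinM.
  exact/within_factor_bounds/hC.
Qed.
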